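(* Let $Q^{(\mathrm{N1})}=2xw+2yz$ and $Q^{(\mathrm{Dege})}=2yw+z^2$ in $\mathbb{F}_{11}[x,y,z,w]$. Let $C_i=V(Q^{(\mathrm{N1})},P_i^{(\mathrm{alc})})\subset\mathbb{P}^3$ for $1\le i\le 3$ and $C_j=V(Q^{(\mathrm{Dege})},P_j^{(\mathrm{alc})})\subset\mathbb{P}^3$ for $4\le j\le 9$ be the superspecial curves over $\overline{\mathbb{F}_{11}}$ defined by these quadrics and the cubic forms $P_i^{(\mathrm{alc})}$ listed in the context. Let $\zeta$ be a root of $a^2+7a+2$, which is a primitive element of $\mathbb{F}_{121}$. Then the following hold for the automorphism groups over $\overline{\mathbb{F}_{11}}$, where matrices denote the automorphisms they represent (modulo scalars). (1) $\operatorname{Aut}(C_1)$ has order $12$ and is generated by $\begin{pmatrix}6&3&5&3\\1&6&1&5\\5&3&6&3\\1&5&1&6\end{pmatrix}$ and $\begin{pmatrix}0&6&0&10\\0&8&0&7\\1&0&2&0\\6&0&3&0\end{pmatrix}$, whose orders are $2$ and $6$ respectively. (2) $\operatorname{Aut}(C_2)$ has order $4$ and is generated by $\operatorname{diag}(-1,1,1,-1)$ and $\begin{pmatrix}0&0&0&\zeta^{-6}\\0&0&7&0\\0&8&0&0\\\zeta^{6}&0&0&0\end{pmatrix}$, whose orders are $2$ and $2$ respectively. (3) $\operatorname{Aut}(C_3)$ has order $24$ and is generated by $\begin{pmatrix}0&0&5&2\\7&6&9&8\\0&0&8&9\\2&6&1&8\end{pmatrix}$ and $\begin{pmatrix}9&5&2&5\\1&3&3&2\\8&5&3&5\\4&8&1&9\end{pmatrix}$,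 whose orders are $4$ and $2$ respectively. (4) $\operatorname{Aut}(C_4)$ has order $36$ and is generated by $\begin{pmatrix}1&0&0&0\\0&2&2&10\\0&6&5&9\\0&2&5&2\end{pmatrix}$, $\operatorname{diag}(1,\zeta^{80},\zeta^{80},\zeta^{80})$ and $\begin{pmatrix}1&0&0&0\\0&2&9&10\\0&6&6&9\\0&2&6&2\end{pmatrix}$, whose orders are $6$, $3$ and $2$ respectively. (5) $\operatorname{Aut}(C_5)$ has order $72$ and is generated by $\begin{pmatrix}1&0&0&0\\0&5&2&4\\0&8&0&9\\0&9&3&5\end{pmatrix}$, $\begin{pmatrix}1&0&0&0\\0&3&9&3\\0&6&6&9\\0&5&6&3\end{pmatrix}$ and $\operatorname{diag}(1,\zeta^{80},\zeta^{80},\zeta^{80})$, whose orders are $4$, $2$ and $3$ respectively. (6) $\operatorname{Aut}(C_6)$ has order $12$ and is generated by $\operatorname{diag}(1,\zeta^{80},\zeta^{70},-1)$. (7) $\operatorname{Aut}(C_7)$ has order $3$ and is generated by $\operatorname{diag}(1,1,\zeta^{-40},\zeta^{40})$. (8) $\operatorname{Aut}(C_8)$ has order $12$ and is generated by $\begin{pmatrix}1&0&0&0\\0&\zeta^{4}&\zeta^{-40}&7\\0&\zeta^{-8}&\zeta^{44}&1\\0&\zeta^{28}&\zeta^{32}&7\end{pmatrix}$ and $\begin{pmatrix}1&0&0&0\\0&7&\zeta^{40}&\zeta^{44}\\0&\zeta^{32}&7&\zeta^{40}\\0&\zeta^{28}&\zeta^{32}&7\end{pmatrix}$, whose orders are $3$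 and $2$ respectively. (9) $\operatorname{Aut}(C_9)$ has order $3$ and is generated by $\operatorname{diag}(1,\zeta^{40},\zeta^{-40},1)$.
   Context: The cubic forms, with coefficients in $\mathbb{F}_{11}$, are: $P_1^{(\mathrm{alc})}=x^2y+x^2z+xz^2+4y^3+2y^2z+10y^2w+3yz^2+8yzw+8yw^2+8z^3+7z^2w+7zw^2+4w^3$, $P_2^{(\mathrm{alc})}=x^2y+x^2z+y^3+y^2z+7yz^2+4yw^2+2z^3+9zw^2$, $P_3^{(\mathrm{alc})}=x^2y+x^2z+xz^2+9y^3+6y^2z+5y^2w+8yz^2+5yzw+2yw^2+z^3+2z^2w+7zw^2+w^3$, $P_4^{(\mathrm{alc})}=x^3+y^3+8yz^2+z^2w+2w^3$, $P_5^{(\mathrm{alc})}=x^3+2y^3+4yz^2+z^2w+10w^3$, $P_6^{(\mathrm{alc})}=x^3+xw^2+y^3$, $P_7^{(\mathrm{alc})}=x^3+xzw+y^3+7z^3+w^3$, $P_8^{(\mathrm{alc})}=x^3+xyz+xw^2+y^3+5z^3+4w^3$, $P_9^{(\mathrm{alc})}=x^3+xyz+6xw^2+y^3+8z^3+8w^3$. These curves are known to be nonsingular nonhyperelliptic superspecial curves of genus $4$ (canonically embedded). For $C=V(Q,P)$ over $K=\overline{\mathbb{F}_{11}}$, the automorphism group over $K$ is described as $\operatorname{Aut}(C)=G_K/{\sim}$, where, with $\varphi$ the symmetric coefficient matrix of $Q$, $G_K=\{g\in \mathrm{GL}_4(K): {}^tg\varphi g=\mu\varphi\text{ for some }\mu\in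 K^\times,\ g\cdot P\equiv rP \bmod Q\text{ for some } r\in K^\times\}$, $g\cdot P:=P((x,y,z,w)\cdot{}^tg)$, and $g\sim cg$ for $c\in K^\times$. Generators are given by matrices representing classes in $G_K/{\sim}$, and orders are those of the classes. *)

(* Defs.v *)
From HB Require Import structures.
From mathcomp Require Import all_boot all_order all_algebra.
From mathcomp Require Import mpoly.

Set Implicit Arguments.
Unset Strict Implicit.
Unset Printing Implicit Defensive.

Import GRing.Theory.
Local Open Scope ring_scope.
Local Open Scope quotient_scope.

Section ProjectiveGroup.
Variables (K : fieldType) (n : nat).

Definition GL := {A : 'M[K]_n | A \in unitmx}.

Definition GL_mk (A : 'M[K]_n) (uA : A \in unitmx) : GL := exist _ A uA.

Fact GL_mul_subproof (g h : GL) : val g *m val h \in unitmx.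
Proof. by rewrite unitmx_mul (valP g) (valP h). Qed.

Fact GL_inv_subproof (g : GL) : invmx (val g) \in unitmx.
Proof. by rewrite unitmx_inv (valP g). Qed.

Definition GL_one : GL := GL_mk (unitmx1 K n).
Definition GL_mul (g h : GL) : GL := GL_mk (GL_mul_subproof g h).
Definition GL_inv (g : GL) : GL := GL_mk (GL_inv_subproof g).

Definition scalar_equiv (g h : GL) : bool :=
  is_scalar_mx (val g *m invmx (val h)).

Lemma scalar_equivP (g h : GL) :
  reflect (exists2 c : K, c != 0 & val g = c *: val h) (scalar_equiv g h).
Proof.
have uh := valP h; have ug := valP g.
apply: (iffP is_scalar_mxP) => [[a ea]|[c c0 eg]]; last first.
  by exists c; rewrite eg -scalemxAl mulmxV // scalemx1.
have eg : val g = a *: val h.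
  by rewrite -[LHS](mulmxKV uh) ea mul_scalar_mx.
have [a0|a0] := eqVneq a 0; last by exists a.
have h0 : val h = 0.
  by rewrite -[val h]mulmx1 -(mulmxV ug) [X in X *m invmx _]eg a0 scale0r mul0mx mulmx0.
exists 1; first exact: oner_neq0.
by rewrite eg a0 scale0r h0 scaler0.
Qed.

Lemma scalar_equiv_is_equiv : equiv_class_of scalar_equiv.
Proof.
split=> [g|g h|h g k].
- by apply/scalar_equivP; exists 1; rewrite ?oner_neq0 ?scale1r.
- apply/scalar_equivP/scalar_equivP => -[c c0 e];
    by exists c^-1; rewrite ?invr_eq0 // e scalerA mulVf // scale1r.
- move=> /scalar_equivP[c c0 e] /scalar_equivP[d d0 f].
  by apply/scalar_equivP; exists (c * d); rewrite ?mulf_neq0 // e f scalerA.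
Qed.

Canonical scalar_equiv_equiv := EquivRelPack scalar_equiv_is_equiv.

Definition PGL := {eq_quot scalar_equiv}.
HB.instance Definition _ := Choice.on PGL.
HB.instance Definition _ := EqQuotient.on PGL.

Lemma PGL_eqP (g h : GL) :
  reflect (exists2 c : K, c != 0 & val g = c *: val h)
          (\pi_PGL g == \pi_PGL h).
Proof. rewrite eqmodE; exact: scalar_equivP. Qed.

Lemma PGL_eq_val (g h : GL) : val g = val h -> \pi_PGL g = \pi_PGL h.
Proof. by move=> /val_inj ->. Qed.

Definition PGL_one : PGL := \pi_PGL GL_one.
Definition PGL_mul (a b : PGL) : PGL := \pi_PGL (GL_mul (repr a) (repr b)).
Definition PGL_inv (a : PGL) : PGL := \pi_PGL (GL_inv (repr a)).

Lemma PGL_mulE (g h : GL) :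
  PGL_mul (\pi_PGL g) (\pi_PGL h) = \pi_PGL (GL_mul g h).
Proof.
apply/eqP/PGL_eqP.
have /eqP/PGL_eqP[c c0 eg] : \pi_PGL (repr (\pi_PGL g)) = \pi_PGL g by rewrite reprK.
have /eqP/PGL_eqP[d d0 eh] : \pi_PGL (repr (\pi_PGL h)) = \pi_PGL h by rewrite reprK.
exists (c * d); first by rewrite mulf_neq0.
by rewrite /= eg eh -scalemxAl -scalemxAr scalerA.
Qed.

Lemma PGL_mulA : associative PGL_mul.
Proof.
elim/quotW=> a; elim/quotW=> b; elim/quotW=> c.
rewrite (PGL_mulE b c) (PGL_mulE a b) !PGL_mulE.
by apply: PGL_eq_val; rewrite /= mulmxA.
Qed.

Lemma PGL_mul1 : left_id PGL_one PGL_mul.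
Proof.
elim/quotW=> a; rewrite PGL_mulE.
by apply: PGL_eq_val; rewrite /= mul1mx.
Qed.

Lemma PGL_mulr1 : right_id PGL_one PGL_mul.
Proof.
elim/quotW=> a; rewrite PGL_mulE.
by apply: PGL_eq_val; rewrite /= mulmx1.
Qed.

Lemma PGL_mulV : left_inverse PGL_one PGL_inv PGL_mul.
Proof.
move=> a; rewrite -{2}[a]reprK PGL_mulE.
by apply: PGL_eq_val; rewrite /= mulVmx // (valP (repr a)).
Qed.

Lemma PGL_mulrV : right_inverse PGL_one PGL_inv PGL_mul.
Proof.
move=> a; rewrite -{1}[a]reprK PGL_mulE.
by apply: PGL_eq_val; rewrite /= mulmxV // (valP (repr a)).
Qed.

HB.instance Definition _ :=
  isGroup.Build PGL PGL_mulA PGL_mul1 PGL_mulr1 PGL_mulV PGL_mulrV.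

(* Only meaningful when A is invertible: otherwise [pgl A] is the identity. *)
Definition pgl (A : 'M[K]_n) : PGL := \pi_PGL (insubd GL_one A).

Lemma pglE (g : GL) : pgl (val g) = \pi_PGL g.
Proof. by rewrite /pgl valKd. Qed.

End ProjectiveGroup.

Section GroupNotions.
Variable G : groupType.

Definition has_order (S : G -> Prop) (m : nat) : Prop :=
  exists s : seq G, [/\ uniq s, size s = m & forall a, S a <-> a \in s].

Definition in_generated (gens : seq G) (a : G) : Prop :=
  forall H : {pred G}, group_closed H -> {subset gens <= H} -> a \in H.

Definition elt_order (a : G) (m : nat) : Prop :=
  [/\ (0 < m)%N, (a ^+ m = 1)%g
    & forall k, (0 < k < m)%N -> (a ^+ k <> 1)%g].

End GroupNotions.

Section AutomorphismGroup.
Variables (K : fieldType) (n : nat).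

(* For Q homogeneous quadratic and 2 invertible, this is the symmetric phi with
   Q = \sum_(i, j) phi i j *: ('X_i * 'X_j). *)
Definition sym_coef_mx (Q : {mpoly K[n]}) : 'M[K]_n :=
  \matrix_(i, j) (Q@_(U_(i) + U_(j))%MM / (if i == j then 1 else 2%:R)).

(* The substitution p((x_1, ..., x_n) g^T). *)
Definition mx_act (g : 'M[K]_n) (p : {mpoly K[n]}) : {mpoly K[n]} :=
  p \mPo [tuple \sum_(j < n) g i j *: 'X_j | i < n].

Definition in_GK (Q P : {mpoly K[n]}) (g : 'M[K]_n) : Prop :=
  let phi := sym_coef_mx Q in
  [/\ g \in unitmx,
      exists2 mu : K, mu != 0 & g^T *m phi *m g = mu *: phi
    & exists2 r : K, r != 0 &
        exists h : {mpoly K[n]}, mx_act g P - r *: P = h * Q].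

(* The automorphism group of V(Q, P), i.e. [in_GK Q P] modulo nonzero scalars,
   as a subset of PGL_n(K). *)
Definition Aut (Q P : {mpoly K[n]}) (a : PGL K n) : Prop :=
  exists2 g : 'M[K]_n, in_GK Q P g & a = pgl g.

Definition generated_by (S : PGL K n -> Prop) (gens : seq 'M[K]_n) : Prop :=
  all (fun A => A \in unitmx) gens /\
  (forall a, S a <-> in_generated [seq pgl A | A <- gens] a).

End AutomorphismGroup.

Definition mx4 (K : fieldType) (rows : seq (seq K)) : 'M[K]_4 :=
  \matrix_(i, j) nth 0 (nth [::] rows i) j.

Definition diag4 (K : fieldType) (a b c d : K) : 'M[K]_4 :=
  diag_mx (\row_j [:: a; b; c; d]`_j).

Section Forms.

Local Notation x := ('X_(@Ordinal 4 0 isT) : {mpoly 'F_11[4]}).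
Local Notation y := ('X_(@Ordinal 4 1 isT) : {mpoly 'F_11[4]}).
Local Notation z := ('X_(@Ordinal 4 2 isT) : {mpoly 'F_11[4]}).
Local Notation w := ('X_(@Ordinal 4 3 isT) : {mpoly 'F_11[4]}).

Definition Q_N1 : {mpoly 'F_11[4]} := 2 * x * w + 2 * y * z.
Definition Q_Dege : {mpoly 'F_11[4]} := 2 * y * w + z ^+ 2.

Definition P1_alc : {mpoly 'F_11[4]} :=
  x ^+ 2 * y + x ^+ 2 * z + x * z ^+ 2 + 4 * y ^+ 3 + 2 * y ^+ 2 * z
  + 10 * y ^+ 2 * w + 3 * y * z ^+ 2 + 8 * y * z * w + 8 * y * w ^+ 2
  + 8 * z ^+ 3 + 7 * z ^+ 2 * w + 7 * z * w ^+ 2 + 4 * w ^+ 3.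

Definition P2_alc : {mpoly 'F_11[4]} :=
  x ^+ 2 * y + x ^+ 2 * z + y ^+ 3 + y ^+ 2 * z + 7 * y * z ^+ 2
  + 4 * y * w ^+ 2 + 2 * z ^+ 3 + 9 * z * w ^+ 2.

Definition P3_alc : {mpoly 'F_11[4]} :=
  x ^+ 2 * y + x ^+ 2 * z + x * z ^+ 2 + 9 * y ^+ 3 + 6 * y ^+ 2 * z
  + 5 * y ^+ 2 * w + 8 * y * z ^+ 2 + 5 * y * z * w + 2 * y * w ^+ 2
  + z ^+ 3 + 2 * z ^+ 2 * w + 7 * z * w ^+ 2 + w ^+ 3.

Definition P4_alc : {mpoly 'F_11[4]} :=
  x ^+ 3 + y ^+ 3 + 8 * y * z ^+ 2 + z ^+ 2 * w + 2 * w ^+ 3.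

Definition P5_alc : {mpoly 'F_11[4]} :=
  x ^+ 3 + 2 * y ^+ 3 + 4 * y * z ^+ 2 + z ^+ 2 * w + 10 * w ^+ 3.

Definition P6_alc : {mpoly 'F_11[4]} := x ^+ 3 + x * w ^+ 2 + y ^+ 3.

Definition P7_alc : {mpoly 'F_11[4]} :=
  x ^+ 3 + x * z * w + y ^+ 3 + 7 * z ^+ 3 + w ^+ 3.

Definition P8_alc : {mpoly 'F_11[4]} :=
  x ^+ 3 + x * y * z + x * w ^+ 2 + y ^+ 3 + 5 * z ^+ 3 + 4 * w ^+ 3.

Definition P9_alc : {mpoly 'F_11[4]} :=
  x ^+ 3 + x * y * z + 6 * x * w ^+ 2 + y ^+ 3 + 8 * z ^+ 3 + 8 * w ^+ 3.

End Forms.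

(* Main.v *)
(* An automorphism is a matrix preserving the quadric, and the quadric determines its shape.
   On the cone 2yw + z^2 = 0 the cubic is x^3 + x q + f, the matrix is 1 (+) e Sym^2(M) with
   M in PGL_2, and M preserves the binary forms q and f obtained by parametrizing the conic.
   On 2xw + 2yz = 0, which is P^1 x P^1, the matrix is M (x) N, possibly followed by the
   exchange of the factors, and the cubic becomes a form F of bidegree (3, 3); then M and N
   preserve a sextic covariant of F in each factor. In all cases but one M and N therefore
   permute a set of at least three points of the line (the roots of f, of q, or of the
   covariants), and all these points turn out to be rational over F_121. A projective map is
   determined by the images of three points, so M and N lie in an explicit finite list of
   matrices over F_121, and the theorem becomes a computation in F_121. *)
From Stdlib Require Ring_polynom Ring_theory BinNat Pnat.
From HB Require Import structures.
From mathcomp Require Import all_boot all_order all_algebra.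
From mathcomp Require Import mpoly.
From mathcomp Require Import ring.
Require Import Defs.

Set Implicit Arguments.
Unset Strict Implicit.
Unset Printing Implicit Defensive.

Import GRing.Theory.
Local Open Scope ring_scope.

(** * Computable arithmetic in the field with 121 elements *)

(** The field K is abstract, so nothing can be computed in it. All numerical work is done on the
    concrete type [F121] and on polynomial expressions over it, and is transported along [cval],
    which makes sense in every commutative ring where 11 = 0 and a^2 + 7a + 2 has a root: in K for
    points and matrices, in K[x, y, z, w] for the forms. The search is one-sided. A candidate is
    discarded only when sampled values contradict invariance, and every survivor has to occur in an
    explicit list of products of the given generators. Since the generators are checked to be
    automorphisms, the list is then exactly the group, and its closure under products is a
    consequence. On P^1 x P^1 the form F singles out no finite set of points on either factor, so
    the covariant is built to eliminate the other variable. It has degree 4 in F: three second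
    transvectants in v use up all 12 degrees in v, while transvections of total order 3 in u leave
    12 - 6 = 6. *)

Inductive F11 := d0 | d1 | d2 | d3 | d4 | d5 | d6 | d7 | d8 | d9 | d10.

Definition succ11 (x : F11) : F11 :=
  match x with
  | d0 => d1 | d1 => d2 | d2 => d3 | d3 => d4 | d4 => d5 | d5 => d6
  | d6 => d7 | d7 => d8 | d8 => d9 | d9 => d10 | d10 => d0
  end.
Definition digit (n : nat) : F11 := iter n succ11 d0.
Definition nat_of_digit (x : F11) : nat :=
  match x with
  | d0 => 0 | d1 => 1 | d2 => 2 | d3 => 3 | d4 => 4 | d5 => 5
  | d6 => 6 | d7 => 7 | d8 => 8 | d9 => 9 | d10 => 10
  end.

Definition tabulate (T : Type) (f : F11 -> T) (x : F11) : T :=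
  match x with
  | d0 => f d0 | d1 => f d1 | d2 => f d2 | d3 => f d3 | d4 => f d4 | d5 => f d5
  | d6 => f d6 | d7 => f d7 | d8 => f d8 | d9 => f d9 | d10 => f d10
  end.

(* Normalized into lookup tables, so that plain reduction evaluates them cheaply. *)
Definition add11 : F11 -> F11 -> F11 := Eval vm_compute in
  tabulate (fun x => tabulate (fun y => digit (nat_of_digit x + nat_of_digit y)%N)).
Definition mul11 : F11 -> F11 -> F11 := Eval vm_compute in
  tabulate (fun x => tabulate (fun y => digit (nat_of_digit x * nat_of_digit y)%N)).
Definition opp11 : F11 -> F11 := Eval vm_compute in
  tabulate (fun x => digit (11 - nat_of_digit x)%N).
Definition inv11 : F11 -> F11 := Eval vm_compute in
  tabulate (fun x => iter 9 (mul11 x) d1).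
Definition eq11 : F11 -> F11 -> bool := Eval vm_compute in
  tabulate (fun x => tabulate (fun y => eqn (nat_of_digit x) (nat_of_digit y))).

Arguments add11 : simpl never.
Arguments mul11 : simpl never.
Arguments opp11 : simpl never.
Arguments inv11 : simpl never.

Definition F121 := (F11 * F11)%type.

Definition cst (n : nat) : F121 := (digit n, d0).
Definition lin (a b : nat) : F121 := (digit a, digit b).
Definition c0 : F121 := (d0, d0).
Definition c1 : F121 := (d1, d0).
Definition zc : F121 := (d0, d1).

Definition cadd (x y : F121) : F121 :=
  let: (a, b) := x in let: (c, d) := y in (add11 a c, add11 b d).
Definition copp (x : F121) : F121 := let: (a, b) := x in (opp11 a, opp11 b).
Definition csub (x y : F121) : F121 := cadd x (copp y).
(* The generator satisfies z^2 = 4z + 9. *)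
Definition cmul (x y : F121) : F121 :=
  let: (a, b) := x in let: (c, d) := y in
  match b, d with
  | d0, d0 => (mul11 a c, d0)
  | d0, _ => (mul11 a c, mul11 a d)
  | _, d0 => (mul11 a c, mul11 b c)
  | _, _ =>
    let bd := mul11 b d in
    (add11 (mul11 a c) (mul11 d9 bd),
     add11 (add11 (mul11 a d) (mul11 b c)) (mul11 d4 bd))
  end.
(* The norm of a + bz is a^2 + 4ab + 2b^2, the conjugate a + 4b - bz. *)
Definition cinv (x : F121) : F121 :=
  let: (a, b) := x in
  let n := inv11 (add11 (mul11 a (add11 a (mul11 d4 b))) (mul11 d2 (mul11 b b))) in
  (mul11 n (add11 a (mul11 d4 b)), mul11 n (opp11 b)).
Definition ceq (x y : F121) : bool :=
  let: (a, b) := x in let: (c, d) := y in if eq11 a c then eq11 b d else false.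
Fixpoint cexp (x : F121) (n : nat) : F121 :=
  if n is m.+1 then cmul x (cexp x m) else c1.

Lemma eq11P (x y : F11) : reflect (x = y) (eq11 x y).
Proof. by apply: (iffP idP); case: x; case: y. Qed.

Lemma ceqP (x y : F121) : reflect (x = y) (ceq x y).
Proof.
case: x => a b; case: y => c d /=.
apply: (iffP idP) => [|[-> ->]]; last by case: eq11P => // _; case: eq11P.
by case: eq11P => // ->; case: eq11P => // ->.
Qed.

HB.instance Definition _ := hasDecEq.Build F11 eq11P.

Lemma cmulV (x : F121) : ceq x c0 = false -> cmul x (cinv x) = c1.
Proof. by case: x => a b; case: a; case: b. Qed.

Definition cpoly := Ring_polynom.PExpr F121.

(** This is the normalization behind the [ring] tactic, with coefficients in [F121]. The division
    returns quotient 0 and the whole remainder, as there are no monomial equations to rewrite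
    with. *)
Definition cpoly_eq (p q : cpoly) : bool :=
  let norm := Ring_polynom.norm_subst c0 c1 cadd cmul csub copp ceq
    (fun a b => (c0, a)) 0 [::] in
  Ring_polynom.Peq ceq (norm p) (norm q).

Section Interpretation.
Variables (R : comNzRingType) (z : R).

Definition val11 (x : F11) : R := (nat_of_digit x)%:R.
Definition cval (x : F121) : R := val11 x.1 + val11 x.2 * z.

Definition ceval : seq R -> cpoly -> R :=
  @Ring_polynom.PEeval R 0 1 +%R *%R (fun a b => a - b) -%R F121 cval
    nat BinNat.N.to_nat (fun a n => a ^+ n).

Hypothesis char11 : 11%:R = 0 :> R.
Hypothesis z_root : z ^+ 2 + 7 * z + 2 = 0.

Lemma val_succ11 (x : F11) : val11 (succ11 x) = val11 x + 1.
Proof. by case: x; rewrite /val11 natr1 ?char11. Qed.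

Lemma val_digit (n : nat) : val11 (digit n) = n%:R.
Proof. by elim: n => //= n IHn; rewrite val_succ11 IHn natr1. Qed.

Lemma val_add11 (x y : F11) : val11 (add11 x y) = val11 x + val11 y.
Proof.
have -> : add11 x y = digit (nat_of_digit x + nat_of_digit y)%N by case: x; case: y.
by rewrite val_digit natrD.
Qed.

Lemma val_mul11 (x y : F11) : val11 (mul11 x y) = val11 x * val11 y.
Proof.
have -> : mul11 x y = digit (nat_of_digit x * nat_of_digit y)%N by case: x; case: y.
by rewrite val_digit natrM.
Qed.

Lemma val_opp11 (x : F11) : val11 (opp11 x) = - val11 x.
Proof.
apply/eqP; rewrite -addr_eq0 -val_add11; apply/eqP.
by have -> : add11 (opp11 x) x = d0 by case: x.
Qed.

Lemma val_d0 : val11 d0 = 0. Proof. by []. Qed.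

Lemma sqr_z : z * z = 4%:R * z + 9%:R.
Proof.
apply/eqP; rewrite -subr_eq0 -expr2; apply/eqP.
(* The polynomials z^2 - 4z - 9 and z^2 + 7z + 2 differ by 11 (z + 1). *)
rewrite -[RHS]z_root -[LHS]addr0 -{1}[0](mul0r (z + 1)) -char11; ring.
Qed.

Lemma cval0 : cval c0 = 0. Proof. by rewrite /cval /= val_d0 mul0r addr0. Qed.
Lemma cval1 : cval c1 = 1. Proof. by rewrite /cval /= val_d0 mul0r addr0. Qed.
Lemma cvalz : cval zc = z. Proof. by rewrite /cval /= val_d0 add0r /val11 /= mul1r. Qed.
Lemma cval_cst (n : nat) : cval (cst n) = n%:R.
Proof. by rewrite /cval val_digit val_d0 mul0r addr0. Qed.

Lemma cvalD (x y : F121) : cval (cadd x y) = cval x + cval y.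
Proof.
case: x => a b; case: y => c d; rewrite /cval /= !val_add11; ring.
Qed.

Lemma cvalN (x : F121) : cval (copp x) = - cval x.
Proof. case: x => a b; rewrite /cval /= !val_opp11; ring. Qed.

Lemma cvalB (x y : F121) : cval (csub x y) = cval x - cval y.
Proof. by rewrite cvalD cvalN. Qed.

Lemma cvalM (x y : F121) : cval (cmul x y) = cval x * cval y.
Proof.
case: x => a b; case: y => c d.
have -> : cmul (a, b) (c, d) = (add11 (mul11 a c) (mul11 d9 (mul11 b d)),
  add11 (add11 (mul11 a d) (mul11 b c)) (mul11 d4 (mul11 b d))).
  by case: b; case: d => //; case: a; case: c.
rewrite /cval /= !(val_add11, val_mul11).
move: (val11 a) (val11 b) (val11 c) (val11 d) => A B C D.
transitivity (A * C + (A * D + B * C) * z + B * D * (z * z)); last by ring.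
by rewrite sqr_z /val11 /=; ring.
Qed.

Lemma cvalX (x : F121) (n : nat) : cval (cexp x n) = cval x ^+ n.
Proof. by elim: n => [|n IHn]; rewrite ?cval1 //= cvalM IHn exprS. Qed.

Lemma ceval_eq (l : seq R) (p q : cpoly) : cpoly_eq p q -> ceval l p = ceval l q.
Proof.
have ext : Ring_theory.ring_eq_ext +%R *%R -%R (@eq R).
  by split=> [? ? -> ? ? -> | ? ? -> ? ? -> | ? ? ->].
have ring : Ring_theory.almost_ring_theory 0 1 +%R *%R (fun a b : R => a - b) -%R eq.
  split; [exact: add0r | exact: addrC | exact: addrA | exact: mul1r | exact: mul0r
    | exact: mulrC | exact: mulrA | exact: mulrDl | by move=> a b; rewrite mulNr
    | exact: opprD | by []].
have morph : Ring_theory.ring_morph 0 1 +%R *%R (fun a b : R => a - b) -%R eq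
    c0 c1 cadd cmul csub copp ceq cval.
  split; [exact: cval0 | exact: cval1 | exact: cvalD | exact: cvalB | exact: cvalM
    | exact: cvalN | by move=> x y /ceqP ->].
have power : Ring_theory.power_theory 1 *%R eq BinNat.N.to_nat (fun (a : R) n => a ^+ n).
  split=> a [//|n]; rewrite /Ring_theory.pow_N /BinNat.N.to_nat.
  elim: n => [n IHn|n IHn|//]; rewrite [RHS]/= -IHn.
  + by rewrite Pnat.Pos2Nat.inj_xI exprS multE mulnC exprM expr2.
  + by rewrite Pnat.Pos2Nat.inj_xO multE mulnC exprM expr2.
have div : Ring_theory.div_theory eq cadd cmul cval (fun a b => (c0, a)).
  by split=> a b; rewrite cvalD cvalM cval0 mulr0 add0r.
exact: (Ring_polynom.ring_correct _ ext ring morph power div 0 l [::]).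
Qed.

End Interpretation.

Section Injectivity.
Variables (R : comNzRingType) (z : R).
Hypothesis char11 : 11%:R = 0 :> R.
Hypothesis z_root : z ^+ 2 + 7 * z + 2 = 0.

(** A nonzero element of [F121] has an inverse there, so its image is a unit of R and cannot
    vanish. *)
Lemma cval_eq0 (x : F121) : cval z x = 0 -> x = c0.
Proof.
move=> x0; case E: (ceq x c0); first exact/ceqP.
have /(congr1 (cval z)) := cmulV E.
by rewrite (cvalM char11 z_root) x0 mul0r cval1 => /esym/eqP; rewrite oner_eq0.
Qed.

Lemma cval_inj : injective (cval z).
Proof.
move=> x y /eqP; rewrite -subr_eq0 -(cvalB z char11) => /eqP /cval_eq0.
case: x y => [a b] [c d] [].
by case: a; case: c => // _; case: b; case: d.
Qed.
End Injectivity.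

(** * Evaluation of polynomial expressions under ring morphisms and substitutions *)

Lemma binnth_map (T U : Type) (f : T -> U) (x : T) (k : BinNums.positive) (l : seq T) :
  BinList.nth (f x) k (map f l) = f (BinList.nth x k l).
Proof.
have jump m l' : BinList.jump m [seq f x | x <- l'] = [seq f x | x <- BinList.jump m l'].
  elim: m l' => [m IHm|m IHm|] l' /=; last by case: l'.
    by case: l' => [|? ?] /=; rewrite -?IHm // -[[::]]/(map f [::]) !IHm.
  by rewrite !IHm.
by elim: k l => [k IHk|k IHk|] [|y l] //=; rewrite -?IHk -?jump.
Qed.

Lemma ceval_morph (R S : comNzRingType) (f : {rmorphism R -> S}) (z : R) (l : seq R)
    (p : cpoly) :
  f (ceval z l p) = ceval (f z) [seq f x | x <- l] p.
Proof.
elim: p => //=; rewrite /ceval /= ?rmorph0 ?rmorph1 //.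
- by move=> x; rewrite /cval rmorphD rmorphM !rmorph_nat.
- by move=> k; rewrite -(rmorph0 f) binnth_map.
- by move=> p IHp q IHq; rewrite rmorphD IHp IHq.
- by move=> p IHp q IHq; rewrite rmorphB IHp IHq.
- by move=> p IHp q IHq; rewrite rmorphM IHp IHq.
- by move=> p IHp; rewrite rmorphN IHp.
- by move=> p IHp n; rewrite rmorphXn IHp.
Qed.

Fixpoint csubst (l : seq cpoly) (p : cpoly) : cpoly :=
  match p with
  | Ring_polynom.PEX k => BinList.nth (@Ring_polynom.PEO F121) k l
  | Ring_polynom.PEadd p q => Ring_polynom.PEadd (csubst l p) (csubst l q)
  | Ring_polynom.PEsub p q => Ring_polynom.PEsub (csubst l p) (csubst l q)
  | Ring_polynom.PEmul p q => Ring_polynom.PEmul (csubst l p) (csubst l q)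
  | Ring_polynom.PEopp p => Ring_polynom.PEopp (csubst l p)
  | Ring_polynom.PEpow p n => Ring_polynom.PEpow (csubst l p) n
  | _ => p
  end.

Lemma ceval_subst (R : comNzRingType) (z : R) (l : seq R) (ps : seq cpoly) (p : cpoly) :
  ceval z l (csubst ps p) = ceval z [seq ceval z l q | q <- ps] p.
Proof.
elim: p => //=.
- move=> k; rewrite /ceval /=.
  by rewrite -[RHS]/(BinList.nth (ceval z l (@Ring_polynom.PEO F121)) k _) binnth_map.
- by move=> p IHp q IHq; rewrite /ceval /= -!/(ceval _ _ _) IHp IHq.
- by move=> p IHp q IHq; rewrite /ceval /= -!/(ceval _ _ _) IHp IHq.
- by move=> p IHp q IHq; rewrite /ceval /= -!/(ceval _ _ _) IHp IHq.
- by move=> p IHp; rewrite /ceval /= -!/(ceval _ _ _) IHp.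
- by move=> p IHp n; rewrite /ceval /= -!/(ceval _ _ _) IHp.
Qed.

Declare Scope cpoly_scope.
Delimit Scope cpoly_scope with cpoly.
Bind Scope cpoly_scope with cpoly.
Notation "p + q" := (Ring_polynom.PEadd p%cpoly q%cpoly) : cpoly_scope.
Notation "p - q" := (Ring_polynom.PEsub p%cpoly q%cpoly) : cpoly_scope.
Notation "- p" := (Ring_polynom.PEopp p%cpoly) : cpoly_scope.
Notation "p * q" := (Ring_polynom.PEmul p%cpoly q%cpoly) : cpoly_scope.
Notation "p ^+ n" := (Ring_polynom.PEpow p%cpoly (BinNat.N.of_nat n)) : cpoly_scope.
Notation "n %:F" := (Ring_polynom.PEc (cst n)) : cpoly_scope.
Notation "''V_' k" := (@Ring_polynom.PEX F121 (BinPos.Pos.of_succ_nat k))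
  (at level 8, k at level 2, format "''V_' k") : cpoly_scope.

(** * Projective groups and automorphism groups *)

Section ProjectiveClasses.
Variables (K : fieldType) (n : nat).
Implicit Types A B : 'M[K]_n.

Lemma pglM A B : A \in unitmx -> B \in unitmx -> pgl (A *m B) = (pgl A * pgl B)%g.
Proof.
move=> uA uB; rewrite -[A]/(val (GL_mk uA)) -[B]/(val (GL_mk uB)).
by rewrite -[_ *m _]/(val (GL_mul _ _)) !pglE -PGL_mulE.
Qed.

Lemma pgl1 : pgl 1%:M = 1%g :> PGL K n.
Proof. by rewrite -[1%:M]/(val (GL_one K n)) pglE. Qed.

Lemma pglV A : A \in unitmx -> pgl (invmx A) = (pgl A)^-1%g.
Proof.
move=> uA; apply: (mulIg (pgl A)).
by rewrite mulVg -pglM ?unitmx_inv // mulVmx // pgl1.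
Qed.

Lemma pgl_eqP A B : A \in unitmx -> B \in unitmx ->
  pgl A = pgl B <-> exists2 c : K, c != 0 & A = c *: B.
Proof.
move=> uA uB; rewrite -[A]/(val (GL_mk uA)) -[B]/(val (GL_mk uB)) !pglE.
by split=> [/eqP/PGL_eqP //|/PGL_eqP/eqP].
Qed.

Lemma pglZ c A : A \in unitmx -> c != 0 -> pgl (c *: A) = pgl A.
Proof.
move=> uA c0; apply/pgl_eqP => //; last by exists c.
by rewrite unitmxZ ?unitfE.
Qed.

End ProjectiveClasses.

Lemma mpoly_rmorph_ext (R S : comNzRingType) (n : nat)
    (f f' : {rmorphism {mpoly R[n]} -> S}) :
  (forall c, f c%:MP = f' c%:MP) -> (forall i, f 'X_i = f' 'X_i) -> f =1 f'.
Proof.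
move=> fC fX p; elim/mpolyind: p => [|c m p _ _ IHp]; first by rewrite !rmorph0.
rewrite !rmorphD IHp -mul_mpolyC !rmorphM fC mpolyXE_id !rmorph_prod; congr (_ * _ + _).
by apply: eq_bigr => i _; rewrite !rmorphXn fX.
Qed.

Section AutGroup.
Variables (K : fieldType) (n : nat) (Q P : {mpoly K[n]}).
Implicit Types (g h : 'M[K]_n) (p : {mpoly K[n]}).

Definition var_col : 'cV[{mpoly K[n]}]_n := \col_i 'X_i.

Hypothesis Q_quadratic :
  Q%:M = var_col^T *m map_mx (@mpolyC n K) (sym_coef_mx Q) *m var_col :> 'M_1.

Lemma mx_act_rmorph g : exists f : {rmorphism {mpoly K[n]} -> {mpoly K[n]}},
  mx_act g =1 f.
Proof. by exists (comp_mpoly [tuple \sum_(j < n) g i j *: 'X_j | i < n]). Qed.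

Lemma mx_actC g c : mx_act g c%:MP = c%:MP.
Proof. exact: comp_mpolyC. Qed.

Lemma mx_actX g i : mx_act g 'X_i = \sum_(j < n) g i j *: 'X_j.
Proof. by rewrite /mx_act comp_mpolyXU -tnth_nth tnth_mktuple. Qed.

Lemma mx_act_var g : map_mx (mx_act g) var_col = map_mx (@mpolyC n K) g *m var_col.
Proof.
apply/matrixP=> i j; rewrite !mxE mx_actX; apply: eq_bigr => k _.
by rewrite !mxE mul_mpolyC.
Qed.

(** Substitution is contravariant, hence the order of the product. Both sides are ring morphisms in
    p, so they are compared on constants and variables. *)
Lemma mx_actM g h p : mx_act g (mx_act h p) = mx_act (h *m g) p.
Proof.
have [f fE] := mx_act_rmorph g; have [f' fE'] := mx_act_rmorph h.
have [f'' fE''] := mx_act_rmorph (h *m g).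
rewrite fE fE' fE''; apply: (mpoly_rmorph_ext (f := f \o f')) => [c|i] /=.
  by rewrite -fE' -fE'' !mx_actC -fE mx_actC.
rewrite -fE' -fE'' !mx_actX rmorph_sum.
under eq_bigr => j _ do rewrite -mul_mpolyC rmorphM -!fE mx_actC mx_actX mulr_sumr.
rewrite exchange_big; apply: eq_bigr => k _; rewrite mxE scaler_suml.
by apply: eq_bigr => j _; rewrite mul_mpolyC scalerA.
Qed.

Lemma mx_act1 p : mx_act 1%:M p = p.
Proof.
rewrite -[RHS]comp_mpoly_id; congr (_ \mPo _); apply: eq_from_tnth => i.
rewrite !tnth_mktuple (bigD1 i) //= mxE eqxx scale1r big1 ?addr0 // => j ij.
by rewrite mxE eq_sym (negbTE ij) scale0r.
Qed.

(** This turns the matrix condition of [in_GK] into one on polynomials, so that congruences modulo Q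
    can be composed and inverted. *)
Lemma mx_act_quadric g mu :
  g^T *m sym_coef_mx Q *m g = mu *: sym_coef_mx Q -> mx_act g Q = mu%:MP * Q.
Proof.
move=> gQ; have [f fE] := mx_act_rmorph g.
have fvar : map_mx f var_col = map_mx (@mpolyC n K) g *m var_col.
  by rewrite -mx_act_var; apply: eq_map_mx => p; rewrite fE.
have /matrixP/(_ 0 0) : (mx_act g Q)%:M = (mu%:MP * Q)%:M :> 'M_1; last by rewrite !mxE.
rewrite fE -map_scalar_mx {1}Q_quadratic !map_mxM -map_trmx fvar.
have -> : map_mx f (map_mx (@mpolyC n K) (sym_coef_mx Q))
    = map_mx (@mpolyC n K) (sym_coef_mx Q).
  by apply/matrixP=> i j; rewrite !mxE -fE mx_actC.
rewrite trmx_mul map_trmx !mulmxA -(mulmxA _ _ (map_mx _ (sym_coef_mx Q))).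
rewrite -(mulmxA var_col^T _ (map_mx _ g)) -!map_mxM gQ.
rewrite (_ : map_mx _ (mu *: _) = mu%:MP *: map_mx (@mpolyC n K) (sym_coef_mx Q)).
  by rewrite -scalemxAr -scalemxAl -Q_quadratic scale_scalar_mx.
by apply/matrixP=> i j; rewrite !mxE; apply: mpolyCM.
Qed.

Lemma in_GK1 : in_GK Q P 1%:M.
Proof.
split; [exact: unitmx1 | exists 1; rewrite ?oner_neq0 ?scale1r ?trmx1 ?mul1mx ?mulmx1 // |].
by exists 1; rewrite ?oner_neq0 //; exists 0; rewrite mx_act1 scale1r subrr mul0r.
Qed.

Lemma in_GKM g h : in_GK Q P g -> in_GK Q P h -> in_GK Q P (g *m h).
Proof.
move=> [ug [mu mu0 gQ] [r r0 [k gP]]] [uh [nu nu0 hQ] [s s0 [l hP]]].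
split; first by rewrite unitmx_mul ug.
  exists (mu * nu); first by rewrite mulf_neq0.
  rewrite trmx_mul !mulmxA -(mulmxA _ g^T) -(mulmxA _ (g^T *m _) g) gQ.
  by rewrite -scalemxAr -scalemxAl hQ scalerA.
exists (r * s); first by rewrite mulf_neq0.
have [f fE] := mx_act_rmorph h.
exists (r%:MP * l + f k * nu%:MP).
rewrite -mx_actM (_ : mx_act g P = r *: P + k * Q); last by rewrite -gP addrC subrK.
rewrite fE rmorphD rmorphM -mul_mpolyC rmorphM -!fE mx_actC (mx_act_quadric hQ).
rewrite (_ : mx_act h P = s *: P + l * Q); last by rewrite -hP addrC subrK.
by rewrite -!mul_mpolyC mpolyCM; ring.
Qed.

Lemma in_GKV g : in_GK Q P g -> in_GK Q P (invmx g).
Proof.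
move=> [ug [mu mu0 gQ] [r r0 [k gP]]].
have gQ' : (invmx g)^T *m sym_coef_mx Q *m invmx g = mu^-1 *: sym_coef_mx Q.
  apply: (canRL (scalerK mu0)); rewrite scalemxAl scalemxAr -gQ.
  by rewrite !mulmxA -trmx_mul mulmxV // trmx1 mul1mx -mulmxA mulmxV // mulmx1.
split; [by rewrite unitmx_inv | by exists mu^-1; rewrite ?invr_eq0 |].
exists r^-1; first by rewrite invr_eq0.
have [f fE] := mx_act_rmorph (invmx g).
exists (- (r^-1)%:MP * f k * (mu^-1)%:MP).
have gP' : P - r%:MP * mx_act (invmx g) P = f k * ((mu^-1)%:MP * Q).
  have := congr1 (mx_act (invmx g)) gP.
  rewrite !fE rmorphB -mul_mpolyC !rmorphM -!fE mx_actM mulmxV // mx_act1 mx_actC.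
  by rewrite (mx_act_quadric gQ').
rewrite -!mulrA -gP' mulNr mulrBr mulrA -mpolyCM mulVf // mpolyC1 mul1r opprB.
by rewrite mul_mpolyC.
Qed.

Lemma Aut_group_closed (H : {pred PGL K n}) :
  (forall a, a \in H <-> Aut Q P a) -> group_closed H.
Proof.
move=> HE; split; first by apply/HE; exists 1%:M; [exact: in_GK1 | rewrite pgl1].
move=> a b /HE[g gG ->] /HE[h hG ->]; apply/HE; exists (g *m invmx h).
  exact: in_GKM gG (in_GKV hG).
by have [[ug _ _] [uh _ _]] := (gG, hG); rewrite pglM ?unitmx_inv // pglV.
Qed.

End AutGroup.

(** * Matrices over the field with 121 elements *)

(* Row-major lists of the 16 entries. *)
Definition cmx := seq F121.
Definition ent (A : cmx) (i j : nat) : F121 := nth c0 A (4 * i + j)%N.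
Definition cmmul (A B : cmx) : cmx :=
  [seq cadd (cadd (cmul (ent A i 0) (ent B 0 j)) (cmul (ent A i 1) (ent B 1 j)))
            (cadd (cmul (ent A i 2) (ent B 2 j)) (cmul (ent A i 3) (ent B 3 j)))
  | i <- iota 0 4, j <- iota 0 4].
Definition cid : cmx := [:: c1; c0; c0; c0; c0; c1; c0; c0; c0; c0; c1; c0; c0; c0; c0; c1].
(** A word lists indices of generators; an index out of range stands for the identity. *)
Definition wordmx (gens : seq cmx) (w : seq nat) : cmx :=
  foldr (fun k => cmmul (nth cid gens k)) cid w.
(** Making the first nonzero entry 1 gives a canonical representative up to scalars, so that
    equality in PGL becomes equality of lists. *)
Fixpoint cnorm (s : seq F121) : seq F121 :=
  if s is x :: s' then if ceq x c0 then x :: cnorm s' else map (cmul (cinv x)) s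
  else [::].
Definition cmxeq : cmx -> cmx -> bool := all2 ceq.
Fixpoint cmem (A : cmx) (L : seq cmx) : bool :=
  if L is B :: L' then if cmxeq A B then true else cmem A L' else false.
Fixpoint cuniq (L : seq cmx) : bool :=
  if L is A :: L' then if cmem A L' then false else cuniq L' else true.

Lemma cmxeqP (A B : cmx) : reflect (A = B) (cmxeq A B).
Proof.
elim: A B => [|x A IHA] [|y B]; try by constructor.
apply: (iffP andP) => [[/ceqP-> e]|[<- <-]]; first by congr cons; apply/IHA.
by split; [apply/ceqP | apply/IHA].
Qed.

Lemma cmemP (A : cmx) (L : seq cmx) : reflect (A \in L) (cmem A L).
Proof.
elim: L => [|B L IHL] /=; first by constructor.
rewrite inE; case: cmxeqP => [->|/eqP/negbTE->]; first by rewrite eqxx; constructor.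
exact: IHL.
Qed.

Lemma cuniqE (L : seq cmx) : cuniq L = uniq L.
Proof.
by elim: L => //= A L ->; case: cmemP => // [->|/negP->].
Qed.

Lemma size_wordmx (gens : seq cmx) (w : seq nat) : size (wordmx gens w) = 16%N.
Proof. by case: w. Qed.

Section MatrixInterpretation.
Variables (K : fieldType) (z : K).
Hypothesis char11 : 11%:R = 0 :> K.
Hypothesis z_root : z ^+ 2 + 7 * z + 2 = 0.

Definition mxv (A : cmx) : 'M[K]_4 := \matrix_(i, j) cval z (ent A i j).

Lemma mxvM (A B : cmx) : mxv (cmmul A B) = mxv A *m mxv B.
Proof.
apply/matrixP=> i j; rewrite !mxE !big_ord_recl big_ord0 !mxE.
transitivity (cval z (cadd (cadd (cmul (ent A i 0) (ent B 0 j)) (cmul (ent A i 1) (ent B 1 j)))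
            (cadd (cmul (ent A i 2) (ent B 2 j)) (cmul (ent A i 3) (ent B 3 j))))).
  by case: i => [[|[|[|[|//]]]] ?]; case: j => [[|[|[|[|//]]]] ?].
by rewrite !(cvalD z char11) !(cvalM char11 z_root) addr0 !addrA.
Qed.

Lemma mxv1 : mxv cid = 1%:M.
Proof.
apply/matrixP=> i j; rewrite !mxE; case: i => [[|[|[|[|//]]]] ?];
by case: j => [[|[|[|[|//]]]] ?]; rewrite ?cval0 ?cval1.
Qed.

Lemma cnorm_scale (s : seq F121) : exists2 c, c != c0 & cnorm s = map (cmul c) s.
Proof.
have mul1 : cmul c1 =1 id by case=> a b; case: a; case: b.
elim: s => [|x s [c nc IHs]] /=; first by exists c1.
case E: (ceq x c0); last first.
  exists (cinv x) => //; apply/eqP=> x0; have := cmulV E; rewrite x0.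
  by case: x {E x0} => a b; case: a; case: b.
exists c => //; rewrite IHs; congr (_ :: _); move/ceqP: E => ->.
by case: c {nc IHs} => a b; case: a; case: b.
Qed.

Lemma cval_neq0 (c : F121) : c != c0 -> cval z c != 0.
Proof. by apply: contraNneq => /(cval_eq0 char11 z_root) ->. Qed.

Lemma mxv_cnorm (A : cmx) : exists2 c : K, c != 0 & mxv (cnorm A) = c *: mxv A.
Proof.
have [c nc ->] := cnorm_scale A; exists (cval z c); first exact: cval_neq0.
apply/matrixP=> i j; rewrite !mxE -(cvalM char11 z_root) /ent.
have [lt|ge] := ltnP (4 * i + j) (size A); first by rewrite (nth_map c0).
rewrite !nth_default ?size_map //.
by case: c {nc} => a b; case: a; case: b.
Qed.

(** The factor c lies in K, not necessarily in the image of [F121]. It preserves the position of the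
    first nonzero entry and cancels when dividing by that entry. *)
Lemma cnorm_inj_scale (A B : cmx) (c : K) :
  c != 0 -> size A = 16%N -> size B = 16%N -> mxv A = c *: mxv B -> cnorm A = cnorm B.
Proof.
move=> nc sA sB AB.
have {}AB k : cval z (nth c0 A k) = c * cval z (nth c0 B k).
  have [lt|ge] := ltnP k 16; last by rewrite !nth_default ?sA ?sB // cval0 mulr0.
  have lti : (k %/ 4 < 4)%N by rewrite ltn_divLR.
  have ltj : (k %% 4 < 4)%N by rewrite ltn_mod.
  have /matrixP/(_ (Ordinal lti) (Ordinal ltj)) := AB.
  by rewrite !mxE /ent /= mulnC -divn_eq.
have {sA sB} : size A = size B by rewrite sA sB.
elim: A B AB => [|x A IHA] [|y B] //= AB [sAB].
have xy := AB 0%N; rewrite /= in xy.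
have [/ceqP x0|nx] := boolP (ceq x c0).
  have /(cval_eq0 char11 z_root) y0 : cval z y = 0.
    apply/eqP; have /esym/eqP := xy.
    by rewrite x0 cval0 mulf_eq0 (negbTE nc).
  rewrite x0 y0 /=; congr (_ :: _); apply: IHA => // k; exact: (AB k.+1).
have [/ceqP y0|ny] := boolP (ceq y c0).
  case/negP: nx; apply/ceqP; apply: (cval_eq0 char11 z_root).
  by rewrite xy y0 cval0 mulr0.
apply: (@eq_from_nth _ c0) => [|k]; rewrite /= !size_map ?sAB // => lt.
rewrite -!map_cons !(nth_map c0) //= ?sAB //.
apply: (cval_inj char11 z_root); rewrite !(cvalM char11 z_root).
have /(congr1 (cval z)) := cmulV (negbTE ny); have /(congr1 (cval z)) := cmulV (negbTE nx).
rewrite !(cvalM char11 z_root) cval1 (AB k) xy => xV yV.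
rewrite -[RHS]mul1r -xV -[RHS]mulrA; rewrite -[LHS]mulr1 -yV; ring.
Qed.

Lemma mxvX (A : cmx) (k : nat) :
  mxv (wordmx [:: A] (nseq k 0%N)) = iter k (mulmx (mxv A)) 1%:M.
Proof. by elim: k => [|k IHk] /=; rewrite ?mxv1 // mxvM IHk. Qed.

Lemma iter_mulmx_unit (A : 'M[K]_4) (k : nat) :
  A \in unitmx -> iter k (mulmx A) 1%:M \in unitmx.
Proof. by move=> uA; elim: k => [|k IHk] /=; rewrite ?unitmx1 // unitmx_mul uA. Qed.

Lemma pgl_iter (A : 'M[K]_4) (k : nat) :
  A \in unitmx -> pgl (iter k (mulmx A) 1%:M) = (pgl A ^+ k)%g.
Proof.
move=> uA; elim: k => [|k IHk] /=; first exact: pgl1.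
by rewrite pglM ?iter_mulmx_unit // IHk expgS.
Qed.

Definition order_test (A : cmx) (m : nat) : bool :=
  [&& (0 < m)%N, cmxeq (cnorm (wordmx [:: A] (nseq m 0%N))) cid
    & all (fun k => ~~ cmxeq (cnorm (wordmx [:: A] (nseq k 0%N))) cid) (iota 1 m.-1)].

(** A positive power of A is proportional to the identity by a nonzero factor, which forces A to be
    invertible; the order computation thus also guarantees that [pgl] is meaningful. *)
Lemma order_test_unit (A : cmx) (m : nat) : order_test A m -> mxv A \in unitmx.
Proof.
case/and3P; case: m => // m _ /cmxeqP Am _.
have [c nc] := mxv_cnorm (wordmx [:: A] (nseq m.+1 0%N)).
rewrite Am mxv1 mxvX /= => E.
have /(congr1 (fun B => B \in unitmx)) := E.
by rewrite unitmx1 unitmxZ ?unitfE // unitmx_mul => /esym /andP[].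
Qed.

Lemma order_testP (A : cmx) (m : nat) : order_test A m -> elt_order (pgl (mxv A)) m.
Proof.
move=> test; have uA := order_test_unit test; case/and3P: test => m0 /cmxeqP Am /allP nA.
split=> // [|k /andP[k0 km]]; rewrite -pgl_iter // -mxvX.
  have [c nc] := mxv_cnorm (wordmx [:: A] (nseq m 0%N)); rewrite Am mxv1 => E.
  by rewrite -(@pglZ _ _ c) ?mxvX ?iter_mulmx_unit // -mxvX -E pgl1.
rewrite -pgl1 => /pgl_eqP[||c nc]; rewrite ?unitmx1 ?mxvX ?iter_mulmx_unit //.
rewrite -mxvX -mxv1 => /(cnorm_inj_scale nc) E.
have /nA/negP[] : k \in iota 1 m.-1 by rewrite mem_iota k0 add1n prednK.
by apply/cmxeqP; rewrite E // size_wordmx.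
Qed.

(** * Certifying that a list of words exhausts the automorphism group *)

Section AutList.
Variables (Q P : {mpoly K[4]}) (gens : seq cmx) (words : seq (seq nat)) (m : nat).
Hypothesis Q_quadratic :
  Q%:M = (var_col K 4)^T *m map_mx (@mpolyC 4 K) (sym_coef_mx Q) *m var_col K 4 :> 'M_1.

Definition elements : seq cmx := [seq cnorm (wordmx gens w) | w <- words].

Hypothesis gens_GK : forall A, A \in gens -> in_GK Q P (mxv A).
Hypothesis elements_uniq : cuniq elements && (size words == m).
Hypothesis GK_elements : forall g, in_GK Q P g ->
  exists A (c : K), [/\ c != 0, cmem (cnorm A) elements & g = c *: mxv A].

Lemma wordmx_GK (w : seq nat) : in_GK Q P (mxv (wordmx gens w)).
Proof.
elim: w => [|k w IHw] /=; first by rewrite mxv1; exact: in_GK1.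
rewrite mxvM; apply: (in_GKM Q_quadratic _ IHw); have [lt|ge] := ltnP k (size gens).
  by apply: gens_GK; rewrite mem_nth.
by rewrite (nth_default _ ge) mxv1; exact: in_GK1.
Qed.

Lemma mem_elements (A : cmx) : A \in elements ->
  exists2 w, mxv A \in unitmx & pgl (mxv A) = pgl (mxv (wordmx gens w)).
Proof.
case/mapP=> w _ ->; have [c nc ->] := mxv_cnorm (wordmx gens w).
by have [uw _ _] := wordmx_GK w; exists w; rewrite ?pglZ // unitmxZ ?unitfE.
Qed.

(** Words in the generators are automorphisms because [in_GK] is closed under products; conversely
    [GK_elements] confines every automorphism to the list. *)
Lemma AutP (a : PGL K 4) : Aut Q P a <-> a \in [seq pgl (mxv A) | A <- elements].
Proof.
split=> [[g gG ->]|/mapP[A /mem_elements[w _ ->] ->]]; last first.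
  by exists (mxv (wordmx gens w)) => //; exact: wordmx_GK.
have [A [c [nc /cmemP eA gE]]] := GK_elements gG.
apply/mapP; exists (cnorm A) => //; have [d nd ->] := mxv_cnorm A.
have uA : mxv A \in unitmx.
  by have [] := gG; rewrite gE unitmxZ // unitfE.
by rewrite gE !pglZ.
Qed.

Lemma Aut_has_order : has_order (Aut Q P) m.
Proof.
exists [seq pgl (mxv A) | A <- elements]; split; last exact: AutP; last first.
  by rewrite !size_map; case/andP: elements_uniq => _ /eqP.
rewrite map_inj_in_uniq; first by case/andP: elements_uniq; rewrite cuniqE.
move=> _ _ /mapP[v _ ->] /mapP[w _ ->].
have [c nc ->] := mxv_cnorm (wordmx gens v); have [d nd ->] := mxv_cnorm (wordmx gens w).
have [[uv _ _] [uw _ _]] := (wordmx_GK v, wordmx_GK w).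
rewrite !pglZ // => /pgl_eqP[] // e ne /(cnorm_inj_scale ne) -> //; exact: size_wordmx.
Qed.

Lemma Aut_generated : generated_by (Aut Q P) [seq mxv A | A <- gens].
Proof.
split; first by apply/allP=> _ /mapP[A /gens_GK[uA _ _] ->].
move=> a; split=> [|gen_a].
  move=> /AutP/mapP[A /mem_elements[w _ ->] ->] H closedH gensH.
  elim: w => [|k w IHw] /=; first by rewrite mxv1 pgl1; case: closedH.
  have [[uw _ _] [uk _ _]] := (wordmx_GK w, wordmx_GK [:: k]).
  rewrite /= mxvM mxv1 mulmx1 in uk; rewrite mxvM pglM //.
  apply: group_closedM => //; have [lt|ge] := ltnP k (size gens).
    by apply: gensH; rewrite -map_comp; apply/mapP; exists (nth cid gens k); rewrite ?mem_nth.
  by rewrite nth_default // mxv1 pgl1; case: closedH.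
(* The list itself, seen as a predicate, is a subgroup containing the generators, so it can be taken
   for H in [in_generated]. *)
apply/AutP; apply: gen_a; first exact: Aut_group_closed Q_quadratic _ (fun b => iff_sym (AutP b)).
move=> b; rewrite -map_comp => /mapP[A gA ->].
by apply/AutP; exists (mxv A); first exact: gens_GK.
Qed.

End AutList.
End MatrixInterpretation.

(** * The quadrics and cubics as computable polynomials *)

Definition cQ_N1 : cpoly := 2%:F * 'V_0 * 'V_3 + 2%:F * 'V_1 * 'V_2.
Definition cQ_Dege : cpoly := 2%:F * 'V_1 * 'V_3 + 'V_2 ^+ 2.
Definition cP1_alc : cpoly := 'V_0 ^+ 2 * 'V_1 + 'V_0 ^+ 2 * 'V_2 + 'V_0 * 'V_2 ^+ 2 +
  4%:F * 'V_1 ^+ 3 + 2%:F * 'V_1 ^+ 2 * 'V_2 + 10%:F * 'V_1 ^+ 2 * 'V_3 + 3%:F * 'V_1 *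
  'V_2 ^+ 2 + 8%:F * 'V_1 * 'V_2 * 'V_3 + 8%:F * 'V_1 * 'V_3 ^+ 2 + 8%:F * 'V_2 ^+ 3 +
  7%:F * 'V_2 ^+ 2 * 'V_3 + 7%:F * 'V_2 * 'V_3 ^+ 2 + 4%:F * 'V_3 ^+ 3.
Definition cP2_alc : cpoly := 'V_0 ^+ 2 * 'V_1 + 'V_0 ^+ 2 * 'V_2 + 'V_1 ^+ 3 + 'V_1 ^+
  2 * 'V_2 + 7%:F * 'V_1 * 'V_2 ^+ 2 + 4%:F * 'V_1 * 'V_3 ^+ 2 + 2%:F * 'V_2 ^+ 3 + 9%:F
  * 'V_2 * 'V_3 ^+ 2.
Definition cP3_alc : cpoly := 'V_0 ^+ 2 * 'V_1 + 'V_0 ^+ 2 * 'V_2 + 'V_0 * 'V_2 ^+ 2 +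
  9%:F * 'V_1 ^+ 3 + 6%:F * 'V_1 ^+ 2 * 'V_2 + 5%:F * 'V_1 ^+ 2 * 'V_3 + 8%:F * 'V_1 *
  'V_2 ^+ 2 + 5%:F * 'V_1 * 'V_2 * 'V_3 + 2%:F * 'V_1 * 'V_3 ^+ 2 + 'V_2 ^+ 3 + 2%:F *
  'V_2 ^+ 2 * 'V_3 + 7%:F * 'V_2 * 'V_3 ^+ 2 + 'V_3 ^+ 3.
Definition cP4_alc : cpoly := 'V_0 ^+ 3 + 'V_1 ^+ 3 + 8%:F * 'V_1 * 'V_2 ^+ 2 + 'V_2 ^+
  2 * 'V_3 + 2%:F * 'V_3 ^+ 3.
Definition cP5_alc : cpoly := 'V_0 ^+ 3 + 2%:F * 'V_1 ^+ 3 + 4%:F * 'V_1 * 'V_2 ^+ 2 +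
  'V_2 ^+ 2 * 'V_3 + 10%:F * 'V_3 ^+ 3.
Definition cP6_alc : cpoly := 'V_0 ^+ 3 + 'V_0 * 'V_3 ^+ 2 + 'V_1 ^+ 3.
Definition cP7_alc : cpoly := 'V_0 ^+ 3 + 'V_0 * 'V_2 * 'V_3 + 'V_1 ^+ 3 + 7%:F * 'V_2
  ^+ 3 + 'V_3 ^+ 3.
Definition cP8_alc : cpoly := 'V_0 ^+ 3 + 'V_0 * 'V_1 * 'V_2 + 'V_0 * 'V_3 ^+ 2 + 'V_1
  ^+ 3 + 5%:F * 'V_2 ^+ 3 + 4%:F * 'V_3 ^+ 3.
Definition cP9_alc : cpoly := 'V_0 ^+ 3 + 'V_0 * 'V_1 * 'V_2 + 6%:F * 'V_0 * 'V_3 ^+ 2 +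
  'V_1 ^+ 3 + 8%:F * 'V_2 ^+ 3 + 8%:F * 'V_3 ^+ 3.

Definition linform (s : seq F121) : cpoly :=
  Ring_polynom.PEc (nth c0 s 0) * 'V_0 + Ring_polynom.PEc (nth c0 s 1) * 'V_1
  + Ring_polynom.PEc (nth c0 s 2) * 'V_2 + Ring_polynom.PEc (nth c0 s 3) * 'V_3.
Definition rowforms (A : cmx) : seq cpoly :=
  [seq linform [seq ent A i j | j <- iota 0 4] | i <- iota 0 4].
Definition ctr (A : cmx) : cmx := [seq ent A j i | i <- iota 0 4, j <- iota 0 4].

Definition phi_N1 : cmx := [:: c0; c0; c0; c1; c0; c0; c1; c0; c0; c1; c0; c0; c1; c0; c0; c0].
Definition phi_Dege : cmx := [:: c0; c0; c0; c0; c0; c0; c0; c1; c0; c0; c1; c0; c0; c1; c0; c0].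

(* [s] lists the coefficients of the linear form h with g.P - P = hQ; all the
   generators of the theorem have r = 1. *)
Definition GK_test (phi : cmx) (q p : cpoly) (A : cmx) (mu : F121) (s : seq F121) : bool :=
  [&& ~~ ceq mu c0, cmxeq (cmmul (cmmul (ctr A) phi) A) (map (cmul mu) phi)
    & cpoly_eq (csubst (rowforms A) p) (p + linform s * q)].

Definition o0 : 'I_4 := @Ordinal 4 0 isT.
Definition o1 : 'I_4 := @Ordinal 4 1 isT.
Definition o2 : 'I_4 := @Ordinal 4 2 isT.
Definition o3 : 'I_4 := @Ordinal 4 3 isT.

Lemma big_ord4 (V : nmodType) (F : 'I_4 -> V) :
  \sum_(i < 4) F i = F o0 + F o1 + F o2 + F o3.
Proof.
rewrite !big_ord_recl big_ord0 addr0 !addrA.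
by congr (F _ + F _ + F _ + F _); apply: val_inj.
Qed.

Lemma ord4P (P : 'I_4 -> Prop) : P o0 -> P o1 -> P o2 -> P o3 -> forall i, P i.
Proof.
move=> p0 p1 p2 p3 [[|[|[|[|//]]]] lt].
- by rewrite (_ : Ordinal lt = o0) //; apply: val_inj.
- by rewrite (_ : Ordinal lt = o1) //; apply: val_inj.
- by rewrite (_ : Ordinal lt = o2) //; apply: val_inj.
- by rewrite (_ : Ordinal lt = o3) //; apply: val_inj.
Qed.

Section Curves.
Variables (K : fieldType) (emb : {rmorphism 'F_11 -> K}) (zeta : K).
Hypothesis zeta_root : zeta ^+ 2 + 7 * zeta + 2 = 0.

Lemma K_char11 : 11%:R = 0 :> K.
Proof. by rewrite -(rmorph_nat emb) (_ : 11%:R = 0) ?rmorph0 //; apply: val_inj. Qed.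
Let char11 := K_char11.

Definition vars : seq {mpoly K[4]} := [:: 'X_o0; 'X_o1; 'X_o2; 'X_o3].

Lemma mpoly_char11 : 11%:R = 0 :> {mpoly K[4]}.
Proof. by rewrite -(rmorph_nat (@mpolyC 4 K)) char11 rmorph0. Qed.

Lemma mpoly_zeta_root : zeta%:MP ^+ 2 + 7 * zeta%:MP + 2 = 0 :> {mpoly K[4]}.
Proof.
by rewrite -[RHS](rmorph0 (@mpolyC 4 K)) -zeta_root !(rmorphD, rmorphM, rmorphXn, rmorph_nat).
Qed.

Definition embeds (Q : {mpoly 'F_11[4]}) (q : cpoly) : Prop :=
  map_mpoly emb Q = ceval zeta%:MP vars q.

Lemma embedsD P Q p q : embeds P p -> embeds Q q -> embeds (P + Q) (p + q).
Proof. by rewrite /embeds rmorphD /= => -> ->. Qed.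
Lemma embedsM P Q p q : embeds P p -> embeds Q q -> embeds (P * Q) (p * q).
Proof. by rewrite /embeds rmorphM /= => -> ->. Qed.
Lemma embedsX P p n : embeds P p -> embeds (P ^+ n) (p ^+ n).
Proof. by rewrite /embeds rmorphXn /= => ->; rewrite /ceval /= Nnat.Nat2N.id. Qed.
Lemma embedsC n : embeds n%:R n%:F.
Proof. by rewrite /embeds rmorph_nat /ceval /= cval_cst ?mpoly_char11. Qed.
Lemma embeds_var i (lt : (i < 4)%N) : embeds 'X_(Ordinal lt) 'V_i.
Proof.
rewrite /embeds /= map_mpolyX; case: i lt => [|[|[|[|//]]]] lt;
by congr 'X_[U_(_)]; apply: val_inj.
Qed.

Ltac embed Q q := change (embeds Q q); rewrite /Q /q;
  repeat match goal with |- embeds _ ?q => match q with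
    | Ring_polynom.PEadd _ _ => apply: embedsD
    | Ring_polynom.PEmul _ _ => apply: embedsM
    | Ring_polynom.PEpow _ _ => apply: embedsX
    | Ring_polynom.PEX _ _ => apply: embeds_var
    | Ring_polynom.PEc _ => apply: embedsC
    end end.

Lemma cQ_N1E : map_mpoly emb Q_N1 = ceval zeta%:MP vars cQ_N1. Proof. embed Q_N1 cQ_N1. Qed.
Lemma cQ_DegeE : map_mpoly emb Q_Dege = ceval zeta%:MP vars cQ_Dege.
Proof. embed Q_Dege cQ_Dege. Qed.
Lemma cP1E : map_mpoly emb P1_alc = ceval zeta%:MP vars cP1_alc. Proof. embed P1_alc cP1_alc. Qed.
Lemma cP2E : map_mpoly emb P2_alc = ceval zeta%:MP vars cP2_alc. Proof. embed P2_alc cP2_alc. Qed.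
Lemma cP3E : map_mpoly emb P3_alc = ceval zeta%:MP vars cP3_alc. Proof. embed P3_alc cP3_alc. Qed.
Lemma cP4E : map_mpoly emb P4_alc = ceval zeta%:MP vars cP4_alc. Proof. embed P4_alc cP4_alc. Qed.
Lemma cP5E : map_mpoly emb P5_alc = ceval zeta%:MP vars cP5_alc. Proof. embed P5_alc cP5_alc. Qed.
Lemma cP6E : map_mpoly emb P6_alc = ceval zeta%:MP vars cP6_alc. Proof. embed P6_alc cP6_alc. Qed.
Lemma cP7E : map_mpoly emb P7_alc = ceval zeta%:MP vars cP7_alc. Proof. embed P7_alc cP7_alc. Qed.
Lemma cP8E : map_mpoly emb P8_alc = ceval zeta%:MP vars cP8_alc. Proof. embed P8_alc cP8_alc. Qed.
Lemma cP9E : map_mpoly emb P9_alc = ceval zeta%:MP vars cP9_alc. Proof. embed P9_alc cP9_alc. Qed.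

Lemma mnm_pair_eq (a b i j : 'I_4) :
  ((U_(a) + U_(b))%MM == (U_(i) + U_(j))%MM :> 'X_{1..4}) =
  ((a == i) && (b == j)) || ((a == j) && (b == i)).
Proof.
apply/eqP/idP => [/mnmP E|/orP[] /andP[/eqP-> /eqP->] //]; last by rewrite addmC.
have {}E k : ((a == k) + (b == k) = (i == k) + (j == k))%N by rewrite -!mnm1E -!mnmDE.
have [ai|nai] := eqVneq a i.
  by have := E j; rewrite ai => /addnI; rewrite eqxx; case: eqP.
have := E i; have := E a; rewrite eqxx (negbTE nai) (eq_sym i a) (negbTE nai) eqxx.
by rewrite (eq_sym a j); case: (b == a); case: (j == a); case: (b == i); case: (j == i).
Qed.

Lemma quad_coef (a b i j : 'I_4) :
  ('X_a * 'X_b : {mpoly K[4]})@_(U_(i) + U_(j)) =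
  (((a == i) && (b == j)) || ((a == j) && (b == i)))%:R.
Proof. by rewrite -mpolyXD mcoeffX mnm_pair_eq. Qed.

Lemma two_neq0 : 2%:R != 0 :> K.
Proof.
rewrite -(rmorph_nat emb) fmorph_eq0; by [].
Qed.

Lemma sym_coef_N1 : sym_coef_mx (map_mpoly emb Q_N1) = mxv zeta phi_N1.
Proof.
have -> : map_mpoly emb Q_N1 = 2%:MP * ('X_o0 * 'X_o3) + 2%:MP * ('X_o1 * 'X_o2).
  by rewrite cQ_N1E /ceval /cval /val11 /= (rmorph_nat (@mpolyC 4 K)); ring.
apply/matrixP; do 2![apply: ord4P]; rewrite !mxE mcoeffD !mcoeffCM !quad_coef /=;
  by rewrite ?cval0 ?cval1 ?mulr0 ?addr0 ?add0r ?mul0r // mulr1 divff ?two_neq0.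
Qed.

Lemma sym_coef_Dege : sym_coef_mx (map_mpoly emb Q_Dege) = mxv zeta phi_Dege.
Proof.
have -> : map_mpoly emb Q_Dege = 2%:MP * ('X_o1 * 'X_o3) + 1%:MP * ('X_o2 * 'X_o2).
  by rewrite cQ_DegeE /ceval /cval /val11 /= (rmorph_nat (@mpolyC 4 K)) mpolyC1; ring.
apply/matrixP; do 2![apply: ord4P]; rewrite !mxE mcoeffD !mcoeffCM !quad_coef /=;
  by rewrite ?cval0 ?cval1 ?mulr0 ?addr0 ?add0r ?mul0r // ?mulr1 ?divff ?two_neq0 ?oner_neq0.
Qed.

Ltac quadratic sym QE := apply/matrixP=> i j; rewrite !ord1 mxE eqxx mulr1n sym QE !mxE big_ord4;
  rewrite !mxE !big_ord4 !mxE !cval0 !cval1 mpolyC0 mpolyC1 /ceval /cval /val11 /=; ring.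

Lemma quadratic_N1 : (map_mpoly emb Q_N1)%:M =
  (var_col K 4)^T *m map_mx (@mpolyC 4 K) (sym_coef_mx (map_mpoly emb Q_N1)) *m var_col K 4
  :> 'M_1.
Proof. quadratic sym_coef_N1 cQ_N1E. Qed.

Lemma quadratic_Dege : (map_mpoly emb Q_Dege)%:M =
  (var_col K 4)^T *m map_mx (@mpolyC 4 K) (sym_coef_mx (map_mpoly emb Q_Dege)) *m var_col K 4
  :> 'M_1.
Proof. quadratic sym_coef_Dege cQ_DegeE. Qed.

Lemma trmx_mxv (A : cmx) : (mxv zeta A)^T = mxv zeta (ctr A).
Proof. by apply/matrixP; do 2![apply: ord4P]; rewrite !mxE. Qed.

Lemma mx_act_ceval (A : cmx) (p : cpoly) :
  mx_act (mxv zeta A) (ceval zeta%:MP vars p) = ceval zeta%:MP vars (csubst (rowforms A) p).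
Proof.
have [f fE] := mx_act_rmorph (mxv zeta A).
rewrite fE ceval_morph -fE mx_actC ceval_subst; congr (ceval _ _ p).
have row i : f 'X_i = ceval zeta%:MP vars (linform [seq ent A i j | j <- iota 0 4]).
  rewrite -fE mx_actX big_ord4 !mxE -!mul_mpolyC /ceval /=.
  have cvalC c : cval zeta%:MP c = (cval zeta c)%:MP_[4].
    by rewrite /cval /val11 rmorphD rmorphM !rmorph_nat.
  by rewrite !cvalC.
by rewrite /= !row.
Qed.

Section Curve.
Variables (Q P : {mpoly K[4]}) (phi : cmx) (q p : cpoly).
Hypotheses (QE : Q = ceval zeta%:MP vars q) (PE : P = ceval zeta%:MP vars p).
Hypothesis phiE : sym_coef_mx Q = mxv zeta phi.

Lemma GK_testP (A : cmx) (mu : F121) (s : seq F121) :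
  mxv zeta A \in unitmx -> GK_test phi q p A mu s -> in_GK Q P (mxv zeta A).
Proof.
move=> uA /and3P[nmu /cmxeqP phiA actP]; split=> //.
  exists (cval zeta mu).
    by apply: cval_neq0 => //; apply: contraNneq nmu => ->; apply/ceqP.
  rewrite phiE trmx_mxv -!(mxvM char11 zeta_root) phiA.
  apply/matrixP=> i j; rewrite !mxE -(cvalM char11 zeta_root) /ent.
  have [lt|ge] := ltnP (4 * i + j) (size phi); first by rewrite (nth_map c0).
  rewrite !nth_default ?size_map //.
  by case: mu {nmu phiA} => a b; case: a; case: b.
exists 1; first exact: oner_neq0.
exists (ceval zeta%:MP vars (linform s)).
rewrite scale1r PE mx_act_ceval (ceval_eq mpoly_char11 mpoly_zeta_root vars actP) QE.
by rewrite /ceval /= addrC addKr.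
Qed.

(** At a zero of Q the unknown cofactor h disappears. From here on the cubic condition is used only
    through these values. *)
Lemma GK_eval (g : 'M[K]_4) : in_GK Q P g -> exists2 r : K, r != 0 &
  forall v : 'I_4 -> K, ceval zeta [:: v o0; v o1; v o2; v o3] q = 0 ->
  ceval zeta [seq \sum_(j < 4) g i j * v j | i <- [:: o0; o1; o2; o3]] p =
  r * ceval zeta [:: v o0; v o1; v o2; v o3] p.
Proof.
case=> _ _ [r r0 [h gP]]; exists r => // v qv0.
have evalE c : (ceval zeta%:MP vars c).@[v] = ceval zeta [:: v o0; v o1; v o2; v o3] c.
  by rewrite ceval_morph /= mevalC !mevalXU.
have := congr1 (meval v) gP.
rewrite mevalB mevalZ mevalM PE QE !evalE qv0 mulr0 => /eqP; rewrite subr_eq0 => /eqP <-.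
have [f fE] := mx_act_rmorph g.
rewrite fE ceval_morph -fE mx_actC ceval_morph /= mevalC.
congr (ceval _ _ p); rewrite -!fE !mx_actX !raddf_sum /=.
by congr [:: _; _; _; _]; apply: eq_bigr => j _; rewrite mevalZ mevalXU.
Qed.

End Curve.
End Curves.

(** * Projective transformations of the line mapping finite sets of points *)

Section Plane.
Variable T : Type.
Variables (add sub mul : T -> T -> T).
Definition pt : Type := T * T.
Definition mat2 : Type := pt * pt.
Definition bracket (p q : pt) : T := sub (mul p.1 q.2) (mul p.2 q.1).
Definition apply2 (M : mat2) (p : pt) : pt :=
  (add (mul M.1.1 p.1) (mul M.1.2 p.2), add (mul M.2.1 p.1) (mul M.2.2 p.2)).
Definition det2 (M : mat2) : T := bracket M.1 M.2.

(* The map sending p1, p2, p3 to multiples of q1, q2, q3: u is mapped to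
   g1 [u, p2] q1 + g2 [p1, u] q2, where g1 and g2 are adjusted at u = p3. *)
Definition three_point_map (p1 p2 p3 q1 q2 q3 : pt) : mat2 :=
  let g1 := mul (bracket q3 q2) (bracket p1 p3) in
  let g2 := mul (bracket q1 q3) (bracket p3 p2) in
  let a := mul g1 q1.1 in let b := mul g2 q2.1 in
  let c := mul g1 q1.2 in let d := mul g2 q2.2 in
  ((sub (mul a p2.2) (mul b p1.2), sub (mul b p1.1) (mul a p2.1)),
   (sub (mul c p2.2) (mul d p1.2), sub (mul d p1.1) (mul c p2.1))).
End Plane.

Notation cbracket := (bracket csub cmul).
Notation capply2 := (apply2 cadd cmul).
Notation cdet2 := (det2 csub cmul).
Notation cthree_point_map := (three_point_map csub cmul).

Definition cpt_neq0 (p : pt F121) : bool := ~~ (ceq p.1 c0 && ceq p.2 c0).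

Definition maps_into (R1 R2 : seq (pt F121)) (M : mat2 F121) : bool :=
  if ceq (cdet2 M) c0 then false else
  all (fun p => let x := capply2 M p in has (fun q => ceq (cbracket x q) c0) R2) R1.

(** The images of the first three points range over all triples from [R2], which covers every
    projective map sending [R1] into [R2]; the filter keeps the later checks short. *)
Definition candidates (R1 R2 : seq (pt F121)) : seq (mat2 F121) :=
  if R1 is [:: p1, p2, p3 & _] then
    filter (maps_into R1 R2)
      [seq cthree_point_map p1 p2 p3 q.1 q.2 q3
      | q <- [seq (q1, q2) | q1 <- R2, q2 <- R2], q3 <- R2]
  else [::].

Definition points_test (R1 R2 : seq (pt F121)) : bool :=
  if R1 is [:: p1, p2, p3 & _] then
    [&& ~~ ceq (cbracket p1 p2) c0, ~~ ceq (cbracket p1 p3) c0, ~~ ceq (cbracket p3 p2) c0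
      & all cpt_neq0 R2]
  else false.

Section ThreePoints.
Variable K : fieldType.
Local Notation kbracket := (bracket (fun a b : K => a - b) *%R).
Local Notation kapply2 := (apply2 (@GRing.add K) *%R).
Local Notation kdet2 := (det2 (fun a b : K => a - b) *%R).
Local Notation kmap := (three_point_map (fun a b : K => a - b) *%R).

Definition scale2 (c : K) (M : mat2 K) : mat2 K :=
  ((c * M.1.1, c * M.1.2), (c * M.2.1, c * M.2.2)).

Lemma bracket_eq0 (x q : pt K) : q != (0, 0) -> kbracket x q = 0 ->
  exists c, x = (c * q.1, c * q.2).
Proof.
case: x q => [x1 x2] [q1 q2]; rewrite /bracket /= => nq /eqP; rewrite subr_eq0 => /eqP E.
have [q10|q10] := eqVneq q1 0; last first.
  by exists (x1 / q1); rewrite divfK // mulrAC E mulfK.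
have q20 : q2 != 0 by apply: contraNneq nq => ->; rewrite q10.
exists (x2 / q2); rewrite divfK // q10 mulr0; congr (_, _).
by apply: (mulIf q20); rewrite E q10 mulr0 mul0r.
Qed.

(** With M p1 = c1 q1 and M p2 = c2 q2, the map is known once the ratio of c1 and c2 is, and the
    third point provides this ratio. *)
Lemma three_points (M : mat2 K) (p1 p2 p3 q1 q2 q3 : pt K) :
  kdet2 M != 0 -> q1 != (0, 0) -> q2 != (0, 0) -> q3 != (0, 0) ->
  kbracket p1 p2 != 0 -> kbracket p1 p3 != 0 -> kbracket p3 p2 != 0 ->
  kbracket (kapply2 M p1) q1 = 0 -> kbracket (kapply2 M p2) q2 = 0 ->
  kbracket (kapply2 M p3) q3 = 0 ->
  exists2 c, c != 0 & M = scale2 c (kmap p1 p2 p3 q1 q2 q3).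
Proof.
move=> dM n1 n2 n3 p12 p13 p32 /(bracket_eq0 n1)[c1 E1] /(bracket_eq0 n2)[c2 E2].
have Mdet : c1 * c2 * kbracket q1 q2 = kdet2 M * kbracket p1 p2.
  transitivity (kbracket (kapply2 M p1) (kapply2 M p2)); first by rewrite E1 E2 /bracket /=; ring.
  by rewrite /det2 /bracket /=; ring.
have : c1 * c2 * kbracket q1 q2 != 0 by rewrite Mdet mulf_neq0.
rewrite !mulf_eq0 !negb_or => /andP[/andP[c10 c20] q12].
move=> E3.
(* Apply M to the identity [p1,p2] p3 = [p3,p2] p1 + [p1,p3] p2 and take the bracket with q3. *)
have rel : c1 * (kbracket q1 q3 * kbracket p3 p2)
    = c2 * (kbracket q3 q2 * kbracket p1 p3).
  apply/eqP; rewrite -subr_eq0; apply/eqP.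
  transitivity (kbracket p1 p2 * kbracket (kapply2 M p3) q3); last by rewrite E3 mulr0.
  transitivity (kbracket p3 p2 * kbracket (kapply2 M p1) q3
    + kbracket p1 p3 * kbracket (kapply2 M p2) q3).
    by rewrite E1 E2 /bracket /=; ring.
  by rewrite /bracket /=; ring.
set g1 := kbracket q3 q2 * kbracket p1 p3 in rel; set g2 := kbracket q1 q3 * kbracket p3 p2 in rel.
(* If g1 vanished, [rel] would make g2 vanish too; then q1 would be a multiple of q3 and [q3,q2] =
   0, contradicting [q1,q2] != 0. *)
have g10 : g1 != 0.
  apply/eqP => g10; move: rel; rewrite g10 mulr0 => /eqP.
  rewrite mulf_eq0 (negbTE c10) /= mulf_eq0 (negbTE p32) orbF => /eqP q13.
  move/eqP: g10; rewrite mulf_eq0 (negbTE p13) orbF => /eqP q32.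
  have [d E] := bracket_eq0 n3 q13.
  move: q12; rewrite /bracket E /= (_ : _ - _ = d * kbracket q3 q2);
    first by rewrite q32 mulr0 eqxx.
  by rewrite /bracket; ring.
exists (c1 / (g1 * kbracket p1 p2)).
  by rewrite mulf_neq0 // invr_eq0 mulf_neq0.
have c2E : c2 = c1 * g2 / g1 by apply: (canRL (mulfK g10)); rewrite -rel.
(* Cramer's rule for one row (a, b) of M, where [i] selects the coordinate of the image points. *)
have inv i : forall a b, a * p1.1 + b * p1.2 = c1 * i q1 -> a * p2.1 + b * p2.2 = c2 * i q2 ->
   a = c1 / (g1 * kbracket p1 p2) * (g1 * i q1 * p2.2 - g2 * i q2 * p1.2) /\
   b = c1 / (g1 * kbracket p1 p2) * (g2 * i q2 * p1.1 - g1 * i q1 * p2.1).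
  move=> a b F1 F2; split; apply: (mulIf p12).
    transitivity ((a * p1.1 + b * p1.2) * p2.2 - (a * p2.1 + b * p2.2) * p1.2).
      by rewrite /bracket; ring.
    by rewrite F1 F2 c2E; field; rewrite g10 p12.
  transitivity ((a * p2.1 + b * p2.2) * p1.1 - (a * p1.1 + b * p1.2) * p2.1).
    by rewrite /bracket; ring.
  by rewrite F1 F2 c2E; field; rewrite g10 p12.
have [a1 b1] := inv fst _ _ (congr1 fst E1) (congr1 fst E2).
have [a2 b2] := inv snd _ _ (congr1 snd E1) (congr1 snd E2).
rewrite [LHS]surjective_pairing [M.1]surjective_pairing [M.2]surjective_pairing.
by rewrite [in LHS]a1 [in LHS]a2 [in LHS]b1 [in LHS]b2.
Qed.

Variable z : K.
Hypothesis char11 : 11%:R = 0 :> K.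
Hypothesis z_root : z ^+ 2 + 7 * z + 2 = 0.

Definition pt_val (p : pt F121) : pt K := (cval z p.1, cval z p.2).
Definition mat2_val (M : mat2 F121) : mat2 K := (pt_val M.1, pt_val M.2).

Lemma bracket_val p q : cval z (cbracket p q) = kbracket (pt_val p) (pt_val q).
Proof. by rewrite /bracket (cvalB z char11) !(cvalM char11 z_root). Qed.

Lemma apply2_val M p : pt_val (capply2 M p) = kapply2 (mat2_val M) (pt_val p).
Proof. by rewrite /apply2 /pt_val /= !(cvalD z char11) !(cvalM char11 z_root). Qed.

Lemma apply2_scale c M p :
  kapply2 (scale2 c M) p = (c * (kapply2 M p).1, c * (kapply2 M p).2).
Proof. by rewrite /apply2 /=; congr (_, _); ring. Qed.

Lemma three_point_map_val p1 p2 p3 q1 q2 q3 : mat2_val (cthree_point_map p1 p2 p3 q1 q2 q3) =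
  kmap (pt_val p1) (pt_val p2) (pt_val p3) (pt_val q1) (pt_val q2) (pt_val q3).
Proof.
rewrite /mat2_val /pt_val /three_point_map /= !(cvalB z char11) !(cvalM char11 z_root).
by rewrite !bracket_val.
Qed.

Lemma ceqF x : ~~ ceq x c0 -> cval z x != 0.
Proof. by move=> nx; apply: cval_neq0 => //; apply: contraNneq nx => ->; apply/ceqP. Qed.

Lemma cval_ceq0 x : cval z x = 0 -> ceq x c0.
Proof. by move/(cval_eq0 char11 z_root)/ceqP. Qed.

Lemma pt_val_neq0 p : cpt_neq0 p -> pt_val p != (0, 0).
Proof.
by apply: contraNneq => -[/cval_ceq0 -> /cval_ceq0 ->].
Qed.

Lemma candidatesP (R1 R2 : seq (pt F121)) (M : mat2 K) :
  points_test R1 R2 -> kdet2 M != 0 ->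
  (forall p, p \in R1 -> exists2 q, q \in R2 & kbracket (kapply2 M (pt_val p)) (pt_val q) = 0) ->
  exists2 M0, M0 \in candidates R1 R2 & exists2 c, c != 0 & M = scale2 c (mat2_val M0).
Proof.
case: R1 => // p1 [//|p2 [//|p3 R]] /and4P[n12 n13 n32 /allP nR2] dM MR.
have [q1 q1R e1] : exists2 q, q \in R2 & kbracket (kapply2 M (pt_val p1)) (pt_val q) = 0.
  by apply: MR; rewrite !inE eqxx.
have [q2 q2R e2] : exists2 q, q \in R2 & kbracket (kapply2 M (pt_val p2)) (pt_val q) = 0.
  by apply: MR; rewrite !inE eqxx orbT.
have [q3 q3R e3] : exists2 q, q \in R2 & kbracket (kapply2 M (pt_val p3)) (pt_val q) = 0.
  by apply: MR; rewrite !inE eqxx !orbT.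
have [||||||c c0' ME] := three_points dM _ _ _ _ _ _ e1 e2 e3;
  rewrite -?bracket_val ?ceqF ?pt_val_neq0 ?nR2 //.
rewrite -three_point_map_val in ME.
set M0 := cthree_point_map p1 p2 p3 q1 q2 q3 in ME.
exists M0; last by exists c.
rewrite mem_filter; apply/andP; split; last first.
  by apply/allpairsP; exists ((q1, q2), q3); split=> //; apply/allpairsP; exists (q1, q2).
rewrite /maps_into; case: ifP => [/ceqP d0|_].
  case/eqP: dM; rewrite ME; transitivity (c * c * kdet2 (mat2_val M0)).
    by rewrite /det2 /bracket /=; ring.
  by rewrite /det2 -bracket_val -/(cdet2 M0) d0 cval0 mulr0.
apply/allP=> p /MR[q qR2]; rewrite ME apply2_scale -apply2_val => e.
apply/hasP; exists q => //; apply: cval_ceq0; rewrite bracket_val.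
by apply: (mulfI c0'); rewrite mulr0 -e /bracket /=; ring.
Qed.
End ThreePoints.

(** * Curves on the quadric cone *)

Local Arguments cst n : simpl never.
Local Arguments cadd x y : simpl never.
Local Arguments cmul x y : simpl never.

Definition cceval : seq F121 -> cpoly -> F121 :=
  @Ring_polynom.PEeval F121 c0 c1 cadd cmul csub copp F121 id nat BinNat.N.to_nat cexp.

Lemma cceval_val (R : comNzRingType) (z : R) (char11 : 11%:R = 0 :> R)
    (z_root : z ^+ 2 + 7 * z + 2 = 0) (l : seq F121) (p : cpoly) :
  cval z (cceval l p) = ceval z [seq cval z x | x <- l] p.
Proof.
elim: p => //=; rewrite /ceval /cceval /= ?cval0 ?cval1 //.
- by move=> k; rewrite -(cval0 z) binnth_map.
- by move=> p IHp q IHq; rewrite (cvalD z char11) IHp IHq.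
- by move=> p IHp q IHq; rewrite (cvalB z char11) IHp IHq.
- by move=> p IHp q IHq; rewrite (cvalM char11 z_root) IHp IHq.
- by move=> p IHp; rewrite (cvalN z char11) IHp.
- by move=> p IHp n; rewrite (cvalX char11 z_root) IHp.
Qed.

(* The action on (y, z, w) of the substitution M of (s, t), where
   (y, z, w) = (s^2, st, -t^2/2) parametrizes the conic 2yw + z^2 = 0. *)
Definition ccone_mx (e : F121) (M : mat2 F121) : cmx :=
  let: ((a, b), (c, d)) := M in
  [:: c1; c0; c0; c0;
      c0; cmul e (cmul a a); cmul e (cmul (cst 2) (cmul a b)); cmul e (cmul (cst 9) (cmul b b));
      c0; cmul e (cmul a c); cmul e (cadd (cmul a d) (cmul b c)); cmul e (cmul (cst 9) (cmul b d));
      c0; cmul e (cmul (cst 5) (cmul c c)); cmul e (cmul (cst 10) (cmul c d)); cmul e (cmul d d)].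

Definition binary_hom (n : nat) (f : cpoly) : bool :=
  cpoly_eq (csubst [:: 'V_2 * 'V_0; 'V_2 * 'V_1]%cpoly f)
    ('V_2 ^+ n * csubst [:: 'V_0; 'V_1]%cpoly f).

(** The coefficient 5 is -1/2 modulo 11. The absence of an x^2 term matters: it is what makes the
    first row of an automorphism diagonal in [cone_GK]. *)
Definition cone_cubic (p q f : cpoly) : bool :=
  cpoly_eq (csubst [:: 'V_0; 'V_1 ^+ 2; 'V_1 * 'V_2; 5%:F * 'V_2 ^+ 2]%cpoly p)
    ('V_0 ^+ 3 + 'V_0 * csubst [:: 'V_1; 'V_2]%cpoly q + csubst [:: 'V_1; 'V_2]%cpoly f).

Lemma sqrt_exists (K : closedFieldType) (y : K) : exists x, x ^+ 2 = y.
Proof.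
have [x xE] := @solve_monicpoly K 2 (fun i => if i == 0%N then y else 0) isT.
by exists x; rewrite xE !big_ord_recl big_ord0 /= mulr1 mul0r !addr0.
Qed.

Section Cone.
Variables (K : closedFieldType) (emb : {rmorphism 'F_11 -> K}) (zeta : K).
Hypothesis zeta_root : zeta ^+ 2 + 7 * zeta + 2 = 0.
Let char11 := K_char11 emb.
Let two0 := two_neq0 emb.
Local Notation kbracket := (bracket (fun a b : K => a - b) *%R).
Local Notation kapply2 := (apply2 (@GRing.add K) *%R).
Local Notation kdet2 := (det2 (fun a b : K => a - b) *%R).

Definition cone_mx (e : K) (M : mat2 K) : 'M[K]_4 :=
  let: ((a, b), (c, d)) := M in
  mx4 [:: [:: 1; 0; 0; 0];
          [:: 0; e * a ^+ 2; e * (2 * a * b); - (e * (2 * b ^+ 2))];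
          [:: 0; e * (a * c); e * (a * d + b * c); - (e * (2 * b * d))];
          [:: 0; - (e * c ^+ 2 / 2); - (e * (c * d)); e * d ^+ 2]].

Lemma five_half : 5%:R = - (2%:R)^-1 :> K.
Proof.
apply: (mulIf two0); rewrite mulNr mulVf //; apply/eqP; rewrite -subr_eq0 opprK.
by rewrite -natrM -[1]/(1%:R) -natrD char11.
Qed.
Lemma ten_opp : 10%:R = - 1 :> K.
Proof. by apply/eqP; rewrite -subr_eq0 opprK -[1]/(1%:R) -natrD char11. Qed.
Lemma nine_opp : 9%:R = - 2%:R :> K.
Proof. by apply/eqP; rewrite -subr_eq0 opprK -natrD char11. Qed.

Lemma ccone_mx_val e M :
  mxv zeta (ccone_mx e M) = cone_mx (cval zeta e) (mat2_val zeta M).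
Proof.
case: M => [[a b] [c d]]; apply/matrixP; do 2![apply: ord4P]; rewrite !mxE /ent /=;
  rewrite ?cval0 ?cval1 // !(cvalM char11 zeta_root) ?(cvalD zeta char11);
  by rewrite ?(cvalM char11 zeta_root) ?(cval_cst zeta char11)
    ?five_half ?ten_opp ?nine_opp //; ring.
Qed.

(** The radical of the form is spanned by the first basis vector, which g must preserve. The other
    columns come from the conic: columns 1 and 3 are isotropic, hence of the form (a^2, ac, -c^2/2)
    up to a factor, by extracting square roots in K; column 2 is orthogonal to both, so it is
    determined up to sign. *)
Lemma cone_structure (g : 'M[K]_4) (mu : K) :
  g \in unitmx -> mu != 0 ->
  g^T *m mxv zeta phi_Dege *m g = mu *: mxv zeta phi_Dege ->
  exists a b c d : K, [/\ a * d - b * c != 0,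
    [/\ g o1 o0 = 0, g o2 o0 = 0 & g o3 o0 = 0],
    [/\ g o1 o1 = a ^+ 2, g o1 o2 = 2 * a * b & g o1 o3 = - (2 * b ^+ 2)],
    [/\ g o2 o1 = a * c, g o2 o2 = a * d + b * c & g o2 o3 = - (2 * b * d)]
    & [/\ g o3 o1 = - (c ^+ 2 / 2), g o3 o2 = - (c * d) & g o3 o3 = d ^+ 2]].
Proof.
move=> ug mu0 gphi.
have B i j : g o1 i * g o3 j + g o3 i * g o1 j + g o2 i * g o2 j
    = mu * mxv zeta phi_Dege i j.
  have /matrixP/(_ i j) := gphi; rewrite [RHS]mxE => <-.
  rewrite mxE big_ord4 !mxE !big_ord4 !mxE /ent /= cval0 cval1; ring.
(* Column 0 of g is orthogonal to all columns of g, hence lies in the radical. *)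
have col0 : [/\ g o1 o0 = 0, g o2 o0 = 0 & g o3 o0 = 0].
  have /(congr1 (mulmx (invmx g^T))) : g^T *m (mxv zeta phi_Dege *m col o0 g) = 0.
    apply/matrixP=> i j; rewrite !mxE big_ord4 !mxE !big_ord4 !mxE /ent /= cval0 cval1.
    have := B i o0; rewrite !mxE /ent /= => E.
    transitivity (mu * cval zeta (nth c0 phi_Dege (4 * i + 0))); first by rewrite -E; ring.
    by move: i {E}; apply: ord4P; rewrite /= cval0 mulr0.
  rewrite mulKmx ?unitmx_tr // mulmx0 => /matrixP E.
  split; [have := E o3 ord0 | have := E o2 ord0 | have := E o1 ord0];
  by rewrite !mxE big_ord4 !mxE /ent /= cval0 cval1 !mul0r mul1r ?addr0 ?add0r.
have {}B i j := B i j; have B11 := B o1 o1; have B13 := B o1 o3; have B33 := B o3 o3.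
have B22 := B o2 o2; have B12 := B o1 o2; have B23 := B o2 o3.
rewrite !mxE /ent /= ?cval0 ?cval1 ?mulr0 ?mulr1 in B11 B13 B33 B22 B12 B23.
have [a [c [Y1 Z1 W1]]] : exists a c,
    [/\ g o1 o1 = a ^+ 2, g o2 o1 = a * c & g o3 o1 = - (c ^+ 2 / 2)].
  have [a aE] := sqrt_exists (g o1 o1); have [a0|na] := eqVneq a 0.
    have [c cE] := sqrt_exists (- (2 * g o3 o1)).
    have y0 : g o1 o1 = 0 by rewrite -aE a0 expr0n.
    have z0 : g o2 o1 = 0.
      by move/eqP: B11; rewrite y0 mulr0 mul0r !add0r mulf_eq0 orbb => /eqP.
    by exists a, c; rewrite a0 y0 z0 cE expr0n mul0r; split=> //; field.
  exists a, (g o2 o1 / a); rewrite -aE; split=> //; first by field.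
  apply: (mulfI two0); apply: (mulfI (expf_neq0 2 na)).
  apply/eqP; rewrite -subr_eq0; apply/eqP; rewrite -[RHS]B11 -aE; field.
  by rewrite two0 na.
have [b [d [Y3 Z3 W3]]] : exists b d,
    [/\ g o1 o3 = - (2 * b ^+ 2), g o2 o3 = - (2 * b * d) & g o3 o3 = d ^+ 2].
  have [d dE] := sqrt_exists (g o3 o3); have [d0|nd] := eqVneq d 0.
    have [b bE] := sqrt_exists (- (g o1 o3 / 2)).
    have w0 : g o3 o3 = 0 by rewrite -dE d0 expr0n.
    have z0 : g o2 o3 = 0.
      by move/eqP: B33; rewrite w0 mulr0 mul0r !add0r mulf_eq0 orbb => /eqP.
    by exists b, d; rewrite d0 w0 z0 bE expr0n mulr0 oppr0; split=> //; field.
  exists (- (g o2 o3 / (2 * d))), d; rewrite -dE; split=> //; last by field; rewrite two0 nd.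
  apply: (mulfI two0); apply: (mulfI (expf_neq0 2 nd)).
  apply/eqP; rewrite -subr_eq0; apply/eqP; rewrite -[RHS]B33 -dE; field.
  by rewrite two0 nd.
have muE : mu = (a * d - b * c) ^+ 2.
  by rewrite -B13 Y1 Z1 W1 Y3 Z3 W3; field.
have det0 : a * d - b * c != 0.
  by apply: contraNneq mu0 => E; rewrite muE E expr0n.
(* V pairs column 2 with the expected column (2ab, ad + bc, -cd), whose pairing with itself is (ad -
   bc)^2 = mu. So k is the coefficient of column 2 along it. *)
pose V := g o1 o2 * - (c * d) + g o3 o2 * (2 * a * b) + g o2 o2 * (a * d + b * c).
pose k := V / mu.
have kE : [/\ g o1 o2 = k * (2 * a * b), g o2 o2 = k * (a * d + b * c)
    & g o3 o2 = k * - (c * d)].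
  rewrite Y1 Z1 W1 in B12; rewrite Y3 Z3 W3 in B23.
  have kV : mu * k = V by rewrite /k mulrC divfK.
  split; apply: (mulfI mu0); rewrite [RHS]mulrA kV muE.
  - transitivity (V * (2 * a * b) + 0 * a ^+ 2 + 0 * - (2 * b ^+ 2)); last by rewrite /V; ring.
    by rewrite -{1}B23 -B12 /V; field.
  - transitivity (V * (a * d + b * c) + 0 * (a * c) + 0 * - (2 * b * d)); last by rewrite /V; ring.
    by rewrite -{1}B23 -B12 /V; field.
  - transitivity (V * - (c * d) + 0 * - (c ^+ 2 / 2) + 0 * d ^+ 2); last by rewrite /V; ring.
    by rewrite -{1}B23 -B12 /V; field.
have [Y2 Z2 W2] := kE.
have : (k - 1) * (k + 1) == 0.
  apply/eqP; apply: (mulfI mu0); rewrite mulr0.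
  transitivity (mu * k ^+ 2 - mu); first by ring.
  by rewrite -[X in _ - X]B22 Y2 Z2 W2 muE; ring.
rewrite mulf_eq0 subr_eq0 addr_eq0 => /orP[] /eqP k1; rewrite k1 in Y2 Z2 W2.
  by exists a, b, c, d; split=> //; split=> //; rewrite ?Y2 ?Z2 ?W2 mul1r.
(* Negating b and d changes the sign of column 2 only, which absorbs k = -1. *)
exists a, (- b), c, (- d); split=> //.
- by rewrite (_ : _ - _ = - (a * d - b * c)) ?oppr_eq0 //; ring.
- by split=> //; rewrite ?Y2 ?Y3; ring.
- by split=> //; rewrite ?Z2 ?Z3; ring.
- by split=> //; rewrite ?W2 ?W3; ring.
Qed.

Definition kev (f : cpoly) (u : pt K) : K := ceval zeta [:: u.1; u.2] f.

Lemma kev_hom (n : nat) (f : cpoly) (c : K) (u : pt K) :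
  binary_hom n f -> kev f (c * u.1, c * u.2) = c ^+ n * kev f u.
Proof.
move=> /(ceval_eq char11 zeta_root [:: u.1; u.2; c]).
by rewrite ceval_subst [in RHS]/ceval /= Nnat.Nat2N.id -!/(ceval zeta _ _) ceval_subst.
Qed.

(** The values at 0, 1, -1 and 2 suffice, because 2 and 6 are invertible modulo 11. *)
Lemma cubic_coefs (A B C D : K) :
  (forall x, A * x ^+ 3 + B * x ^+ 2 + C * x + D = 0) -> [/\ A = 0, B = 0, C = 0 & D = 0].
Proof.
have small n : (0 < n < 11)%N -> n%:R != 0 :> K.
  move=> n11; rewrite -(rmorph_nat emb) fmorph_eq0.
  by move: n n11; do 11![case=> //].
move=> E; have D0 : D = 0 by rewrite -(E 0); ring.
have B0 : B = 0.
  apply: (mulfI (small 2%N isT)); rewrite mulr0.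
  transitivity (A * 1 ^+ 3 + B * 1 ^+ 2 + C * 1 + D
    + (A * (- 1) ^+ 3 + B * (- 1) ^+ 2 + C * (- 1) + D) - 2%:R * D); first by ring.
  by rewrite !E D0; ring.
have A0 : A = 0.
  apply: (mulfI (small 6%N isT)); rewrite mulr0.
  transitivity (A * 2 ^+ 3 + B * 2 ^+ 2 + C * 2 + D
    - 2 * (A * 1 ^+ 3 + B * 1 ^+ 2 + C * 1 + D) - 2 * B + D); first by ring.
  by rewrite !E D0 B0; ring.
split=> //; have := E 1; rewrite A0 B0 D0 => <-; ring.
Qed.

Section ConeCurve.
Variables (P : {mpoly K[4]}) (p q f : cpoly).
Hypothesis PE : P = ceval zeta%:MP (vars K) p.
Hypothesis pE : cone_cubic p q f.
Hypotheses (q_hom : binary_hom 4 q) (f_hom : binary_hom 6 f).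

Lemma cone_cubicE (x : K) (u : pt K) :
  ceval zeta [:: x; u.1 ^+ 2; u.1 * u.2; - (u.2 ^+ 2 / 2)] p = x ^+ 3 + x * kev q u + kev f u.
Proof.
have := ceval_eq char11 zeta_root [:: x; u.1; u.2] pE; rewrite ceval_subst.
have -> : [seq ceval zeta [:: x; u.1; u.2] r
    | r <- [:: 'V_0; 'V_1 ^+ 2; 'V_1 * 'V_2; 5%:F * 'V_2 ^+ 2]%cpoly]
    = [:: x; u.1 ^+ 2; u.1 * u.2; - (u.2 ^+ 2 / 2)].
  have h5 : cval zeta (cst 5) * u.2 ^+ 2 = - (u.2 ^+ 2 / 2).
    by rewrite (cval_cst zeta char11) five_half; field.
  by rewrite -h5.
by move=> ->; rewrite [LHS]/ceval /= -!/(ceval zeta _ _) !ceval_subst.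
Qed.

(** On the line of the cone above u the coordinate x is free, and g acts by x -> kx + L(u).
    Comparing coefficients of x in the two cubics gives k^3 = r, then L = 0 from the x^2 term, and
    finally the behaviour of q and f. *)
Lemma cone_GK (g : 'M[K]_4) : in_GK (map_mpoly emb Q_Dege) P g ->
  exists (M : mat2 K) (c : K), [/\ c != 0, kdet2 M != 0, g = c *: cone_mx 1 M
    & forall u, kev q (kapply2 M u) = kev q u /\ kev f (kapply2 M u) = kev f u].
Proof.
move=> gG; have [r r0 ev] := GK_eval (cQ_DegeE emb zeta) PE gG.
case: gG => ug [mu mu0 gphi] _; rewrite (sym_coef_Dege emb zeta) in gphi.
have [a [b [c [d [det0 [X1 X2 X3] [Y1 Y2 Y3] [Z1 Z2 Z3] [W1 W2 W3]]]]]] :=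
  cone_structure ug mu0 gphi.
set k := g o0 o0; pose L (u : pt K) := g o0 o1 * u.1 ^+ 2 + g o0 o2 * (u.1 * u.2)
  - g o0 o3 * (u.2 ^+ 2 / 2).
pose M : mat2 K := ((a, b), (c, d)).
have k0 : k != 0.
  apply/eqP => k0; have : col o0 g = 0.
    by apply/matrixP; apply: ord4P => j; rewrite !mxE.
  move=> /(congr1 (mulmx (invmx g))); rewrite colE mulmxA mulVmx // mul1mx mulmx0.
  by move/matrixP/(_ o0 ord0)/eqP; rewrite !mxE !eqxx oner_eq0.
have evP x u : (k * x + L u) ^+ 3 + (k * x + L u) * kev q (kapply2 M u) + kev f (kapply2 M u)
    = r * (x ^+ 3 + x * kev q u + kev f u).
  rewrite -!cone_cubicE.
  rewrite -(ev (fun i => nth 0 [:: x; u.1 ^+ 2; u.1 * u.2; - (u.2 ^+ 2 / 2)] i)) /=; last first.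
    by rewrite /ceval /= (cval_cst zeta char11); field.
  congr (ceval _ _ p); rewrite !big_ord4 /= -/k X1 X2 X3 Y1 Y2 Y3 Z1 Z2 Z3 W1 W2 W3 /L.
  by congr [:: _; _; _; _]; field.
have coefs u : [/\ k ^+ 3 = r, L u = 0, k * kev q (kapply2 M u) = r * kev q u
    & kev f (kapply2 M u) = r * kev f u].
  have [x|A0 B0 C0 D0] := @cubic_coefs (k ^+ 3 - r) (3 * k ^+ 2 * L u)
    (3 * k * L u ^+ 2 + k * kev q (kapply2 M u) - r * kev q u)
    (L u ^+ 3 + L u * kev q (kapply2 M u) + kev f (kapply2 M u) - r * kev f u).
    by apply/eqP; rewrite -(subr_eq0 _ 0) subr0; apply/eqP;
       rewrite -[RHS](subrr (r * (x ^+ 3 + x * kev q u + kev f u))) -{1}evP; ring.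
  have three0 : 3%:R != 0 :> K by rewrite -(rmorph_nat emb) fmorph_eq0.
  have L0 : L u = 0.
    by apply: (mulfI three0); apply: (mulfI (expf_neq0 2 k0)); rewrite !mulr0 -B0; ring.
  split=> //; first by apply/eqP; rewrite -subr_eq0 A0.
    by apply/eqP; rewrite -subr_eq0 -C0 L0; apply/eqP; ring.
  by apply/eqP; rewrite -subr_eq0 -D0 L0; apply/eqP; ring.
have rE : r = k ^+ 3 by have [] := coefs (0, 0).
have l1 : g o0 o1 = 0 by have [_ <- _ _] := coefs (1, 0); rewrite /L /=; field.
have l3 : g o0 o3 = 0.
  have [_ E _ _] := coefs (0, 1); apply/eqP; rewrite -oppr_eq0; apply/eqP.
  by rewrite -[RHS](mulr0 2) -E /L /=; field.
have l2 : g o0 o2 = 0.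
  by have [_ <- _ _] := coefs (1, 1); rewrite /L /= l1 l3; field.
(* Dividing the substitution by e multiplies q by e^-4 = k^-2 and f by e^-6 = k^-3, which removes
   all scalar factors. *)
have [e ek] := sqrt_exists k.
have e0 : e != 0 by apply: contraNneq k0 => e0; rewrite -ek e0 expr0n.
exists ((a / e, b / e), (c / e, d / e)), k.
have apE u : kapply2 M u = (e * (kapply2 ((a / e, b / e), (c / e, d / e)) u).1,
    e * (kapply2 ((a / e, b / e), (c / e, d / e)) u).2).
  by rewrite /apply2 /=; congr (_, _); field.
split=> //.
- rewrite /det2 /bracket /= (_ : _ - _ = (a * d - b * c) / k); first by rewrite mulf_neq0 ?invr_eq0.
  by rewrite -ek; field.
- apply/matrixP; do 2![apply: ord4P]; rewrite !mxE /= -/k ?mulr1 ?mulr0 //;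
  by rewrite ?(X1, X2, X3, Y1, Y2, Y3, Z1, Z2, Z3, W1, W2, W3) -?ek //; field; rewrite ?two0 ?e0.
move=> u; have [_ _ Eq Ef] := coefs u; split.
  apply: (mulfI (expf_neq0 3 k0)); rewrite -rE -Eq apE (kev_hom _ _ q_hom) rE -ek; ring.
apply: (mulfI (expf_neq0 3 k0)); rewrite -rE -Ef apE (kev_hom _ _ f_hom) rE -ek; ring.
Qed.

End ConeCurve.
End Cone.

(** * The finite check for curves on the cone *)

Definition test_points : seq (pt F121) :=
  [seq (cst n.1, cst n.2) | n <- [:: (1, 0); (0, 1); (1, 1); (1, 2); (3, 1); (5, 1); (1, 4)]%N].
Definition all_F121 : seq F121 :=
  [seq (a, b) | b <- [:: d0; d1; d2; d3; d4; d5; d6; d7; d8; d9; d10],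
                a <- [:: d0; d1; d2; d3; d4; d5; d6; d7; d8; d9; d10]].
Definition cev (f : cpoly) (u : pt F121) : F121 := cceval [:: u.1; u.2] f.
(** Sampled values can refute proportionality but never establish it. A candidate wrongly kept for
    lack of sample points would make the final check fail, not succeed. *)
Definition not_proportional (s : seq (F121 * F121)) : bool :=
  has (fun v => has (fun w => ~~ ceq (cmul v.1 w.2) (cmul v.2 w.1)) s) s.

(** The common multiplicity of the roots is m + 1, hence positive, so f vanishes at every point of R
    and nowhere else on the line when c is nonzero. *)
Definition roots_test (f : cpoly) (R : seq (pt F121)) (c : F121) (m : nat) : bool :=
  points_test R R && cpoly_eq f (Ring_polynom.PEc c * foldr (fun r p =>
    ('V_0 * Ring_polynom.PEc r.2 - 'V_1 * Ring_polynom.PEc r.1) * p)%cpoly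
    1%:F%cpoly R ^+ m.+1).

(* When M = c M0 the automorphism is [ccone_mx e M0] with e = c^2, and comparing
   values of f, which is homogeneous of degree 6, determines e^3. *)
Definition cone_check (f q : cpoly) (R : seq (pt F121)) (L : seq cmx) : bool :=
  all (fun M =>
    let fv := [seq (cev f (capply2 M u), cev f u) | u <- test_points] in
    let qv := [seq (cev q (capply2 M u), cev q u) | u <- test_points] in
    if not_proportional fv then true else if not_proportional qv then true else
    if [seq v <- fv | ~~ ceq v.1 c0] is v :: _ then
      let rho := cmul v.2 (cinv v.1) in
      if [seq r <- all_F121 | ceq (cexp r 3) rho] is r :: _ then
        all (fun e => if has (fun v => ~~ ceq v.2 (cmul (cmul e e) v.1)) qv then true
                      else cmem (cnorm (ccone_mx e M)) L)
          [seq cmul r (cexp zc k) | k <- [:: 0; 40; 80]%N]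
      else false
    else false)
  (candidates R R).

(** * Roots of unity in K as powers of [zeta] *)

Section PrimitiveRoot.
Variables (K : fieldType) (zeta : K).
Hypothesis char11 : 11%:R = 0 :> K.
Hypothesis zeta_root : zeta ^+ 2 + 7 * zeta + 2 = 0.

Lemma zeta_exp (n : nat) (x : F121) : ceq (cexp zc n) x -> zeta ^+ n = cval zeta x.
Proof. by move=> /ceqP <-; rewrite (cvalX char11 zeta_root) cvalz. Qed.

Lemma zeta_neq1 (n : nat) : ~~ ceq (cexp zc n) c1 -> zeta ^+ n != 1.
Proof.
have -> : zeta ^+ n = cval zeta (cexp zc n) by apply: zeta_exp; apply/ceqP.
apply: contraNneq; rewrite -(cval1 zeta) => /(cval_inj char11 zeta_root) ->.
exact/ceqP.
Qed.

Lemma zeta_primitive : 120.-primitive_root zeta.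
Proof.
have z120 : zeta ^+ 120 = 1 by rewrite (@zeta_exp 120 c1) ?cval1 //; vm_compute.
have [m mprim mdvd] := prim_order_exists (isT : 0 < 120)%N z120.
suff -> : 120%N = m by [].
(* The exponents 60, 40 and 24 are the quotients of 120 by 2, 3 and 5; every proper divisor of 120
   divides one of them. *)
have n60 : zeta ^+ 60 != 1 by apply: zeta_neq1; vm_compute.
have n40 : zeta ^+ 40 != 1 by apply: zeta_neq1; vm_compute.
have n24 : zeta ^+ 24 != 1 by apply: zeta_neq1; vm_compute.
move: n60 n40 n24; rewrite -!(prim_order_dvd mprim).
have : m \in divisors 120 by rewrite -dvdn_divisors.
by rewrite (_ : divisors 120 = [:: 1; 2; 3; 4; 5; 6; 8; 10; 12; 15; 20; 24; 30; 40; 60; 120]%N) //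
  !inE; do 15!(case/orP => [/eqP -> //|]); move/eqP->.
Qed.

Lemma zeta_root_of_unity (n k : nat) (x : K) : (n * k)%N = 120%N -> x ^+ n = 1 ->
  exists2 i, (i < n)%N & x = zeta ^+ (k * i).
Proof.
move=> nk xn; have zprim : n.-primitive_root (zeta ^+ k).
  have n120 : (n %| 120)%N by rewrite -nk dvdn_mulr.
  have := dvdn_prim_root zeta_primitive n120.
  by rewrite -[in (120 %/ n)%N]nk mulKn //; case: n nk {xn n120}.
by have [i ->] := prim_rootP zprim xn; exists i; rewrite ?exprM.
Qed.
End PrimitiveRoot.

Section ConeGroup.
Variables (K : closedFieldType) (emb : {rmorphism 'F_11 -> K}) (zeta : K).
Hypothesis zeta_root : zeta ^+ 2 + 7 * zeta + 2 = 0.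
Let char11 := K_char11 emb.
Local Notation kbracket := (bracket (fun a b : K => a - b) *%R).
Local Notation kapply2 := (apply2 (@GRing.add K) *%R).
Local Notation kdet2 := (det2 (fun a b : K => a - b) *%R).

Lemma cev_val (f : cpoly) (u : pt F121) : cval zeta (cev f u) = kev zeta f (pt_val zeta u).
Proof. by rewrite /cev (cceval_val char11 zeta_root). Qed.

Lemma roots_testP (f : cpoly) (R : seq (pt F121)) (c : F121) (m : nat) :
  roots_test f R c m -> ~~ ceq c c0 ->
  (forall r, r \in R -> kev zeta f (pt_val zeta r) = 0) /\
  (forall u, kev zeta f u = 0 -> exists2 r, r \in R & kbracket u (pt_val zeta r) = 0).
Proof.
case/andP=> _ fR nc.
have E u : kev zeta f u = cval zeta c * (\prod_(r <- R) kbracket u (pt_val zeta r)) ^+ m.+1.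
  rewrite /kev (ceval_eq char11 zeta_root _ fR) /ceval /= -!/(ceval zeta _ _).
  rewrite Pnat.SuccNat2Pos.id_succ; congr (_ * _ ^+ _).
  elim: R {fR} => [|r R IHR]; rewrite ?big_nil ?big_cons -?IHR //.
  by rewrite /= /ceval /= (cval_cst zeta char11).
split=> [r rR|u]; rewrite E.
  have rr : kbracket (pt_val zeta r) (pt_val zeta r) = 0 by rewrite /bracket mulrC subrr.
  by rewrite (big_rem r) //= rr mul0r expr0n mulr0.
move/eqP; rewrite mulf_eq0 (negbTE (ceqF char11 zeta_root nc)) expf_eq0 /=.
rewrite prodf_seq_eq0 => /hasP[r rR /eqP E0]; by exists r.
Qed.

Lemma cone_mx_scale c (M : mat2 K) : cone_mx 1 (scale2 c M) = cone_mx (c ^+ 2) M.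
Proof.
case: M => [[a b] [c' d]]; apply/matrixP; do 2![apply: ord4P]; rewrite !mxE //=; ring.
Qed.

Section Elements.
Variables (P : {mpoly K[4]}) (p q f rt : cpoly) (R : seq (pt F121)) (L : seq cmx).
Variables (c : F121) (m : nat).
Hypothesis PE : P = ceval zeta%:MP (vars K) p.
Hypothesis pE : [&& cone_cubic p q f, binary_hom 4 q & binary_hom 6 f].
Hypothesis rtE : rt = f \/ rt = q.
Hypothesis rootsR : roots_test rt R c m && ~~ ceq c c0.
Hypothesis check : cone_check f q R L.

Lemma cone_elements (g : 'M[K]_4) : in_GK (map_mpoly emb Q_Dege) P g ->
  exists A (k : K), [/\ k != 0, cmem (cnorm A) L & g = k *: mxv zeta A].
Proof.
case/and3P: pE => cubic qhom fhom.
case/(cone_GK zeta_root PE cubic qhom fhom) => M [k [k0 dM gE inv]].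
have invrt u : kev zeta rt (kapply2 M u) = kev zeta rt u.
  by case: rtE => ->; have [] := inv u.
case/andP: rootsR => test nc; have [R_root root_R] := roots_testP test nc.
case/andP: (test) => ptest _.
have [|M0 M0cand [d d0 ME]] := candidatesP char11 zeta_root ptest dM.
  by move=> u /R_root ru; apply: root_R; rewrite invrt.
have invM (h : cpoly) (n : nat) u : binary_hom n h ->
  (forall v, kev zeta h (kapply2 M v) = kev zeta h v) ->
  cval zeta (cev h u) = d ^+ n * cval zeta (cev h (capply2 M0 u)).
  move=> hhom hM; rewrite !cev_val -hM ME apply2_scale (kev_hom emb zeta_root _ _ hhom).
  by rewrite (apply2_val char11 zeta_root).
have fM u := invM f 6%N u fhom (fun v => (inv v).2).
have qM u := invM q 4%N u qhom (fun v => (inv v).1).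
have prop (h : cpoly) (e : K) :
  (forall u, cval zeta (cev h u) = e * cval zeta (cev h (capply2 M0 u))) ->
  not_proportional [seq (cev h (capply2 M0 u), cev h u) | u <- test_points] = false.
  move=> hM; apply/hasP => -[_ /mapP[u _ ->]] /hasP[_ /mapP[v _ ->]] /= /ceqP[].
  by apply: (cval_inj char11 zeta_root); rewrite !(cvalM char11 zeta_root) (hM u) (hM v); ring.
have := allP check _ M0cand; cbv beta zeta; rewrite (prop _ _ fM) (prop _ _ qM).
case Ef: [seq v <- _ | _] => [//|v s].
have : v \in v :: s by rewrite inE eqxx.
rewrite -Ef mem_filter => /andP[nv /mapP[u _ vE]] {Ef s}.
case Er: [seq r <- _ | _] => [//|r s].
have : r \in r :: s by rewrite inE eqxx.
rewrite -Er mem_filter => /andP[/ceqP rE _] {Er s} /allP checkE.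
have d6 : d ^+ 6 = cval zeta r ^+ 3.
  rewrite -(cvalX char11 zeta_root) rE (cvalM char11 zeta_root) vE /= fM -mulrA.
  rewrite -(cvalM char11 zeta_root) cmulV ?cval1 ?mulr1 //.
  by apply: negbTE; rewrite vE in nv.
have r0 : cval zeta r != 0.
  by apply: contraNneq d0 => r0; move/eqP: d6; rewrite r0 expr0n expf_eq0.
(* The scalar d comes from K, but d^2 / r is a cube root of unity, hence a power of [zeta ^+ 40].
   This brings d^2, the only trace of d in the matrix, back to [F121]. *)
have [|i i3 dE] := zeta_root_of_unity char11 zeta_root (erefl : (3 * 40)%N = 120%N)
  (x := d ^+ 2 / cval zeta r).
  by rewrite expr_div_n -exprM d6 divff // expf_neq0.
pose e := cmul r (cexp zc (40 * i)).
have eE : d ^+ 2 = cval zeta e.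
  rewrite (cvalM char11 zeta_root) (cvalX char11 zeta_root) cvalz -dE mulrC divfK //.
have /checkE : e \in [seq cmul r (cexp zc k) | k <- [:: 0; 40; 80]%N].
  apply/mapP; exists (40 * i)%N => //.
  by case: i i3 {dE e eE} => [|[|[|//]]].
clearbody e; case: hasP => [[_ /mapP[w _ ->] /= /ceqP[]]|_ eL].
  by apply: (cval_inj char11 zeta_root); rewrite !(cvalM char11 zeta_root) -eE qM; ring.
exists (ccone_mx e M0), k; split=> //.
by rewrite gE ME cone_mx_scale eE (ccone_mx_val emb zeta_root).
Qed.
End Elements.
End ConeGroup.

(** * A sextic covariant of forms of bidegree (3, 3) *)

Section Covariant.
Variable T : Type.
Variables (cn : nat -> T) (add sub mul : T -> T -> T).
Local Notation "x + y" := (add x y).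
Local Notation "x - y" := (sub x y).
Local Notation "x * y" := (mul x y).

Definition vec : Type := T * T * T * T.
Definition tensor : Type := vec * vec * vec * vec.

Definition vlin (a : T) (p : vec) (b : T) (q : vec) : vec :=
  let: (p0, p1, p2, p3) := p in let: (q0, q1, q2, q3) := q in
  (a * p0 + b * q0, a * p1 + b * q1, a * p2 + b * q2, a * p3 + b * q3).

(* A vector (c0, ..., c3) is the binary cubic c0 s^3 + c1 s^2 t + c2 s t^2 + c3 t^3. *)
Definition cubic_at (c : vec) (v : pt T) : T :=
  let: (x0, x1, x2, x3) := c in let: (s, t) := v in
  x0 * (s * s * s) + x1 * (s * s * t) + x2 * (s * t * t) + x3 * (t * t * t).

(* Second transvectants of two binary cubics and of two binary quadratics. *)
Definition transvectant3 (c d : vec) : T * T * T :=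
  let: (x0, x1, x2, x3) := c in let: (y0, y1, y2, y3) := d in
  (cn 3 * (x0 * y2 + x2 * y0) - cn 2 * (x1 * y1),
   cn 9 * (x0 * y3 + x3 * y0) - (x1 * y2 + x2 * y1),
   cn 3 * (x1 * y3 + x3 * y1) - cn 2 * (x2 * y2)).
Definition transvectant2 (q r : T * T * T) : T :=
  let: (x0, x1, x2) := q in let: (y0, y1, y2) := r in
  cn 2 * (x0 * y2 + x2 * y0) - x1 * y1.
Definition beta (p q r s : vec) : T :=
  transvectant2 (transvectant3 p q) (transvectant3 r s).

(* A tensor k is the symmetric trilinear map k(e_i, e_j, e_l) = k_(i+j+l); the form
   of bidegree (3, 3) that it defines is (u, v) |-> [cubic_at (k(u, u, u)) v]. *)
Definition polar (u : pt T) (k : tensor) : vec * vec * vec :=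
  let: (k0, k1, k2, k3) := k in
  (vlin u.1 k0 u.2 k1, vlin u.1 k1 u.2 k2, vlin u.1 k2 u.2 k3).
Definition polar2 (u : pt T) (h : vec * vec * vec) : vec * vec :=
  let: (h0, h1, h2) := h in (vlin u.1 h0 u.2 h1, vlin u.1 h1 u.2 h2).
Definition polar3 (u : pt T) (g : vec * vec) : vec := vlin u.1 g.1 u.2 g.2.
Definition cube (k : tensor) (u : pt T) : vec := polar3 u (polar2 u (polar u k)).
Definition form33 (k : tensor) (u v : pt T) : T := cubic_at (cube k u) v.

(* With subscripts i for partial derivatives in u, H = (F, F) the Hessian in v and
   B the second transvectant of F with itself in both u and v, this is the
   transvectant of H and B of order 1 in u and 2 in v. *)
Definition jet_covariant (f : vec) (g : vec * vec) (h : vec * vec * vec) (k : tensor) : T :=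
  let: (g0, g1) := g in let: (h0, h1, h2) := h in let: (k0, k1, k2, k3) := k in
  (beta g0 f k1 h2 + beta g0 f k3 h0 - cn 2 * beta g0 f k2 h1)
  - (beta g1 f k0 h2 + beta g1 f k2 h0 - cn 2 * beta g1 f k1 h1).
Definition covariant (k : tensor) (u : pt T) : T :=
  let h := polar u k in let g := polar2 u h in
  jet_covariant (polar3 u g) g h k.

(* The tensor of the form (u, v) |-> F(Mu, v). *)
Definition substl (M : mat2 T) (k : tensor) : tensor :=
  let a := (M.1.1, M.2.1) in let b := (M.1.2, M.2.2) in
  (polar3 a (polar2 a (polar a k)), polar3 b (polar2 a (polar a k)),
   polar3 b (polar2 b (polar a k)), polar3 b (polar2 b (polar b k))).

Definition substr3 (N : mat2 T) (c : vec) : vec :=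
  let: (x0, x1, x2, x3) := c in let: ((a, b), (c, d)) := N in
  (x0 * (a * a * a) + x1 * (a * a * c) + x2 * (a * c * c) + x3 * (c * c * c),
   x0 * (cn 3 * (a * a * b)) + x1 * (a * a * d + cn 2 * (a * b * c))
     + x2 * (b * c * c + cn 2 * (a * c * d)) + x3 * (cn 3 * (c * c * d)),
   x0 * (cn 3 * (a * b * b)) + x1 * (b * b * c + cn 2 * (a * b * d))
     + x2 * (a * d * d + cn 2 * (b * c * d)) + x3 * (cn 3 * (c * d * d)),
   x0 * (b * b * b) + x1 * (b * b * d) + x2 * (b * d * d) + x3 * (d * d * d)).
Definition substr (N : mat2 T) (k : tensor) : tensor :=
  let: (k0, k1, k2, k3) := k in (substr3 N k0, substr3 N k1, substr3 N k2, substr3 N k3).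
End Covariant.

Section Equivariance.
Variable K : comNzRingType.
Local Notation add := (@GRing.add K).
Local Notation sub := (fun a b : K => a - b).
Local Notation mul := (@GRing.mul K).
Local Notation cn := (fun n : nat => n%:R : K).
Local Notation kvlin := (vlin add mul).
Local Notation kbeta := (beta cn add sub mul).
Local Notation kpolar := (polar add mul).
Local Notation kpolar3 := (polar3 add mul).
Local Notation kpolar2 := (polar2 add mul).
Local Notation kcovariant := (covariant cn add sub mul).
Local Notation ksubstl := (substl add mul).
Local Notation ksubstr3 := (substr3 cn add mul).
Local Notation ksubstr := (substr cn add mul).
Local Notation kapply2 := (apply2 add mul).
Local Notation kdet2 := (det2 sub mul).

(** The second argument of [beta] in [jet_covariant] is always f, which a substitution in u changes
    only by moving the point; linearity is used in the three other arguments. *)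
Lemma beta_lin1 a p b p' q r s :
  kbeta (kvlin a p b p') q r s = a * kbeta p q r s + b * kbeta p' q r s.
Proof.
case: p p' q r s => [[[? ?] ?] ?] [[[? ?] ?] ?] [[[? ?] ?] ?] [[[? ?] ?] ?] [[[? ?] ?] ?].
rewrite /beta /=; ring.
Qed.

Lemma beta_lin3 a r b r' p q s :
  kbeta p q (kvlin a r b r') s = a * kbeta p q r s + b * kbeta p q r' s.
Proof.
case: p r' q r s => [[[? ?] ?] ?] [[[? ?] ?] ?] [[[? ?] ?] ?] [[[? ?] ?] ?] [[[? ?] ?] ?].
rewrite /beta /=; ring.
Qed.

Lemma beta_lin4 a s b s' p q r :
  kbeta p q r (kvlin a s b s') = a * kbeta p q r s + b * kbeta p q r s'.
Proof.
case: p s' q r s => [[[? ?] ?] ?] [[[? ?] ?] ?] [[[? ?] ?] ?] [[[? ?] ?] ?] [[[? ?] ?] ?].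
rewrite /beta /=; ring.
Qed.

(** Each of the three second transvectants contributes the square of the determinant. *)
Lemma beta_substr N p q r s :
  kbeta (ksubstr3 N p) (ksubstr3 N q) (ksubstr3 N r) (ksubstr3 N s)
  = kdet2 N ^+ 6 * kbeta p q r s.
Proof.
have tr3 c d : transvectant3 cn add sub mul (ksubstr3 N c) (ksubstr3 N d) =
  let: (q0, q1, q2) := transvectant3 cn add sub mul c d in
  let: ((n0, n1), (n2, n3)) := N in let D := kdet2 N ^+ 2 in
  (D * (q0 * n0 ^+ 2 + q1 * (n0 * n2) + q2 * n2 ^+ 2),
   D * (q0 * (2 * n0 * n1) + q1 * (n0 * n3 + n1 * n2) + q2 * (2 * n2 * n3)),
   D * (q0 * n1 ^+ 2 + q1 * (n1 * n3) + q2 * n3 ^+ 2)).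
  case: c d N => [[[? ?] ?] ?] [[[? ?] ?] ?] [[? ?] [? ?]].
  rewrite /det2 /bracket /=; congr (_, _, _); ring.
rewrite /beta !tr3; case: (transvectant3 _ _ _ _ p q) => [[? ?] ?].
case: (transvectant3 _ _ _ _ r s) => [[? ?] ?].
case: N {tr3} => [[? ?] [? ?]]; rewrite /det2 /bracket /=; ring.
Qed.

Lemma vlin_substr N a p b q :
  ksubstr3 N (kvlin a p b q) = kvlin a (ksubstr3 N p) b (ksubstr3 N q).
Proof.
case: p q N => [[[? ?] ?] ?] [[[? ?] ?] ?] [[? ?] [? ?]] /=; congr (_, _, _, _); ring.
Qed.

Lemma covariant_substr N k u : kcovariant (ksubstr N k) u = kdet2 N ^+ 6 * kcovariant k u.
Proof.
case: k => [[[k0 k1] k2] k3]; rewrite /covariant /polar3 /= -!vlin_substr !beta_substr; ring.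
Qed.

(** This is the chain rule: the polars at u of F composed with M are the polars of F at Mu,
    contracted with the columns a and b of M. The determinant appears twice from B and once from the
    outer transvectant. *)
Lemma covariant_substl M k u :
  kcovariant (ksubstl M k) u = kdet2 M ^+ 3 * kcovariant k (kapply2 M u).
Proof.
have hE a b : kpolar u (ksubstl ((a.1, b.1), (a.2, b.2)) k) =
    let h := kpolar (kapply2 ((a.1, b.1), (a.2, b.2)) u) k in
    (kpolar3 a (kpolar2 a h), kpolar3 b (kpolar2 a h), kpolar3 b (kpolar2 b h)).
  case: k a b u => [[[[[[? ?] ?] ?] [[[? ?] ?] ?]] [[[? ?] ?] ?]] [[[? ?] ?] ?]] [? ?] [? ?] [? ?].
  rewrite /polar3 /=; congr ((_, _, _, _), (_, _, _, _), (_, _, _, _)); ring.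
have gE a b h :
    kpolar2 u (kpolar3 a (kpolar2 a h), kpolar3 b (kpolar2 a h), kpolar3 b (kpolar2 b h))
    = let g := kpolar2 (kapply2 ((a.1, b.1), (a.2, b.2)) u) h in (kpolar3 a g, kpolar3 b g).
  case: h a b u {hE} => [[[[[? ?] ?] ?] [[[? ?] ?] ?]] [[[? ?] ?] ?]] [? ?] [? ?] [? ?].
  rewrite /polar3 /=; congr ((_, _, _, _), (_, _, _, _)); ring.
have fE a b g : kpolar3 u (kpolar3 a g, kpolar3 b g)
    = kpolar3 (kapply2 ((a.1, b.1), (a.2, b.2)) u) g.
  case: g a b u {hE gE} => [[[[? ?] ?] ?] [[[? ?] ?] ?]] [? ?] [? ?] [? ?].
  rewrite /polar3 /=; congr (_, _, _, _); ring.
case: M => [[m0 m1] [m2 m3]].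
rewrite /covariant (hE (m0, m2) (m1, m3)); cbv zeta.
rewrite (gE (m0, m2) (m1, m3)); cbv zeta; rewrite (fE (m0, m2) (m1, m3)).
have -> : (((m0, m2).1, (m1, m3).1), ((m0, m2).2, (m1, m3).2)) = ((m0, m1), (m2, m3)) by [].
(* What remains is multilinear in the jets, so they become variables and [beta] an opaque
   function. *)
move: (kpolar (kapply2 _ u) k) => h; move: (kpolar2 _ h) => g; move: (kpolar3 _ g) => f.
case: h g k {hE} => [[h0 h1] h2] [g0 g1] [[[k0 k1] k2] k3]; rewrite /polar3 /det2 /bracket /=.
rewrite !beta_lin1 !beta_lin3 !beta_lin4 /=; move: kbeta => B; ring.
Qed.

End Equivariance.

(** * Curves on the split quadric *)

Local Arguments csub x y : simpl never.
Local Arguments copp x : simpl never.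

(* The quadric 2xw + 2yz = 0 is parametrized by (x, y, z, w) = [tens u v], that is
   [[x, y], [-z, w]] is the product of the column u and the row v. *)
Definition tens (T : Type) (opp : T -> T) (mul : T -> T -> T) (u v : pt T) : seq T :=
  [:: mul u.1 v.1; mul u.1 v.2; opp (mul u.2 v.1); mul u.2 v.2].

Definition csegre_mx (swap : bool) (M N : mat2 F121) : cmx :=
  let: ((a, b), (c, d)) := M in let: ((e, f), (h, k)) := N in
  let m := cmul in let n x y := copp (cmul x y) in
  if swap then
    [:: m a e; m b e; n a f; m b f; m a h; m b h; n a k; m b k;
        n c e; n d e; m c f; n d f; m c h; m d h; n c k; m d k]
  else
    [:: m a e; m a f; n b e; m b f; m a h; m a k; n b h; m b k;
        n c e; n c f; m d e; n d f; m c h; m c k; n d h; m d k].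

(** The covariant is defined over abstract operations to allow two readings: over K, where its
    equivariance is proved, and here over polynomial expressions, where its factorization is
    computed. *)
Definition cpoly_covariant (k : tensor cpoly) : cpoly :=
  covariant (fun n => n%:F%cpoly) (@Ring_polynom.PEadd F121) (@Ring_polynom.PEsub F121)
    (@Ring_polynom.PEmul F121) k ('V_0, 'V_1)%cpoly.
Definition cpoly_form33 (k : tensor cpoly) : cpoly :=
  form33 (@Ring_polynom.PEadd F121) (@Ring_polynom.PEmul F121) k
    ('V_0, 'V_1)%cpoly ('V_2, 'V_3)%cpoly.

Definition map_vec (T U : Type) (f : T -> U) (c : vec T) : vec U :=
  let: (x0, x1, x2, x3) := c in (f x0, f x1, f x2, f x3).
Definition map_tensor (T U : Type) (f : T -> U) (k : tensor T) : tensor U :=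
  let: (k0, k1, k2, k3) := k in (map_vec f k0, map_vec f k1, map_vec f k2, map_vec f k3).

(* The tensor of 3F, where F has coefficients A i j at u1^(3-i) u2^i v1^(3-j) v2^j. *)
Definition tensor_of (A : cmx) : tensor F121 :=
  let row i x := (cmul x (ent A i 0), cmul x (ent A i 1), cmul x (ent A i 2), cmul x (ent A i 3)) in
  (row 0%N (cst 3), row 1%N c1, row 2%N c1, row 3%N (cst 3)).

Definition tensor_test (p : cpoly) (A : cmx) (swap : bool) : bool :=
  let u := ('V_0, 'V_1)%cpoly in let v := ('V_2, 'V_3)%cpoly in
  let t := tens (@Ring_polynom.PEopp F121) (@Ring_polynom.PEmul F121)
    (if swap then v else u) (if swap then u else v) in
  cpoly_eq (3%:F * csubst t p) (cpoly_form33 (map_tensor (@Ring_polynom.PEc F121) (tensor_of A))).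

Definition covariant_test (A : cmx) (R : seq (pt F121)) (c : F121) : bool :=
  roots_test (cpoly_covariant (map_tensor (@Ring_polynom.PEc F121) (tensor_of A))) R c 0
  && ~~ ceq c c0.

Definition cform (p : cpoly) (u v : pt F121) : F121 := cceval (tens copp cmul u v) p.

(** In contrast with the cone, scalar factors of M and N only rescale the 4 x 4 matrix, so no scalar
    remains to be determined. *)
Definition segre_check (p : cpoly) (L : seq cmx) (swap : bool) (Ms Ns : seq (mat2 F121)) : bool :=
  all (fun M => all (fun N =>
    if not_proportional [seq (if swap then cform p (capply2 M v) (capply2 N u)
                              else cform p (capply2 M u) (capply2 N v), cform p u v)
                        | u <- test_points, v <- test_points] then true
    else cmem (cnorm (csegre_mx swap M N)) L) Ns) Ms.

Section Segre.
Variables (K : closedFieldType) (emb : {rmorphism 'F_11 -> K}) (zeta : K).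
Hypothesis zeta_root : zeta ^+ 2 + 7 * zeta + 2 = 0.
Let char11 := K_char11 emb.
Let two0 := two_neq0 emb.
Local Notation kbracket := (bracket (fun a b : K => a - b) *%R).
Local Notation kapply2 := (apply2 (@GRing.add K) *%R).
Local Notation kdet2 := (det2 (fun a b : K => a - b) *%R).
Local Notation ktens := (tens (@GRing.opp K) *%R).
Local Notation ksub := (fun a b : K => a - b).
Local Notation kcn := (fun n : nat => n%:R : K).
Local Notation kcovariant := (covariant kcn (@GRing.add K) ksub *%R).
Local Notation kform33 := (form33 (@GRing.add K) *%R).

Definition segre_mx (swap : bool) (M N : mat2 K) : 'M[K]_4 :=
  let: ((a, b), (c, d)) := M in let: ((e, f), (h, k)) := N in
  if swap then
    mx4 [:: [:: a * e; b * e; - (a * f); b * f]; [:: a * h; b * h; - (a * k); b * k];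
            [:: - (c * e); - (d * e); c * f; - (d * f)]; [:: c * h; d * h; - (c * k); d * k]]
  else
    mx4 [:: [:: a * e; a * f; - (b * e); b * f]; [:: a * h; a * k; - (b * h); b * k];
            [:: - (c * e); - (c * f); d * e; - (d * f)]; [:: c * h; c * k; - (d * h); d * k]].

Lemma csegre_mx_val swap M N :
  mxv zeta (csegre_mx swap M N) = segre_mx swap (mat2_val zeta M) (mat2_val zeta N).
Proof.
case: M N => [[a b] [c d]] [[e f] [h k]]; apply/matrixP.
by case: swap; do 2![apply: ord4P]; rewrite !mxE /ent /=
  ?(cvalN zeta char11) (cvalM char11 zeta_root).
Qed.

Lemma segre_mx_scale swap x y M N :
  segre_mx swap (scale2 x M) (scale2 y N) = (x * y) *: segre_mx swap M N.
Proof.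
case: M N => [[a b] [c d]] [[e f] [h k]]; apply/matrixP.
by case: swap; do 2![apply: ord4P]; rewrite !mxE /=; ring.
Qed.

Lemma segre_mx_tens swap M N u v :
  [seq \sum_(j < 4) segre_mx swap M N i j * nth 0 (ktens u v) j | i <- [:: o0; o1; o2; o3]] =
  if swap then ktens (kapply2 M v) (kapply2 N u) else ktens (kapply2 M u) (kapply2 N v).
Proof.
case: M N u v => [[a b] [c d]] [[e f] [h k]] [u1 u2] [v1 v2].
by case: swap; rewrite /= !big_ord4 !mxE /tens /=; congr [:: _; _; _; _]; ring.
Qed.

(** The matrix [[x, y], [-z, w]] has determinant xw + yz = 0, hence rank at most one. *)
Lemma isotropic_tens (x y z w : K) : x * w + y * z = 0 ->
  exists p q : pt K, [:: x; y; z; w] = ktens p q.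
Proof.
rewrite /tens; have [x0|nx] := eqVneq x 0.
  rewrite x0 mul0r add0r => /eqP; rewrite mulf_eq0 => /orP[] /eqP yz0.
    by exists (0, 1), (- z, w); rewrite yz0 /= !mul0r !mul1r opprK.
  by exists (y, w), (0, 1); rewrite yz0 /= !mulr0 !mulr1 oppr0.
move=> E; exists (x, - z), (1, y / x) => /=.
congr [:: _; _; _; _]; [by rewrite mulr1|by field|by rewrite mulr1 opprK|].
apply: (mulfI nx); apply/eqP; rewrite -subr_eq0; apply/eqP; rewrite -[RHS]E; field.
exact: nx.
Qed.

Definition polar_N1 (s t : seq K) : K :=
  s`_0 * t`_3 + s`_3 * t`_0 + s`_1 * t`_2 + s`_2 * t`_1.

Lemma polar_tens p q r s : polar_N1 (ktens p q) (ktens r s) = kbracket p r * kbracket q s.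
Proof. by rewrite /polar_N1 /tens /bracket /=; ring. Qed.

(** Write t = r (x) s. Each orthogonality makes r or s parallel to one of the given vectors. If the
    same factor is concerned twice, it is parallel to two independent vectors, so t = 0 and c = 0
    works; otherwise t lies where rulings through the two points meet. *)
Lemma orthogonal_tens (t : seq K) (p q p' q' : pt K) :
  kbracket p p' != 0 -> kbracket q q' != 0 -> size t = 4 ->
  polar_N1 t t = 0 -> polar_N1 (ktens p q) t = 0 -> polar_N1 (ktens p' q') t = 0 ->
  exists c, t = [seq c * x | x <- ktens p q'] \/ t = [seq c * x | x <- ktens p' q].
Proof.
have nz (a b : pt K) : kbracket a b != 0 -> a != (0, 0) /\ b != (0, 0).
  by move=> ab; split; apply: contraNneq ab => ->; rewrite /bracket /= !(mul0r, mulr0) subrr.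
have antisym (a b : pt K) : kbracket a b = - kbracket b a by rewrite /bracket; ring.
move=> pp qq; have [[np np'] [nq nq']] := (nz _ _ pp, nz _ _ qq).
case: t => [|x [|y [|z [|w [|//]]]]] // _ tt.
have {tt}/isotropic_tens[r [s ->]] : x * w + y * z = 0.
  by apply: (mulfI two0); rewrite mulr0 -tt /polar_N1 /=; ring.
rewrite !polar_tens => /eqP; rewrite mulf_eq0 => pq /eqP; rewrite mulf_eq0 => pq'.
have anti0 (a b : pt K) : kbracket a b == 0 -> kbracket b a = 0.
  by rewrite antisym oppr_eq0 => /eqP.
have both (a b c : pt K) : a != (0, 0) -> kbracket a b != 0 -> kbracket a c == 0 ->
    kbracket b c == 0 -> c = (0, 0).
  move=> na ab /anti0/(bracket_eq0 na)[e ->] bc; suff -> : e = 0 by rewrite !mul0r.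
  apply/eqP; move: bc; rewrite antisym oppr_eq0 (_ : kbracket _ _ = e * kbracket a b).
    by rewrite mulf_eq0 (negbTE ab) orbF.
  by rewrite /bracket /=; ring.
case/orP: pq => [rp|sq]; case/orP: pq' => [rp'|sq'].
- have -> := both _ _ _ np pp rp rp'; exists 0; left.
  by rewrite /tens /= !mul0r oppr0.
- have [a ->] := bracket_eq0 np (anti0 _ _ rp); have [b ->] := bracket_eq0 nq' (anti0 _ _ sq').
  by exists (a * b); left; rewrite /tens /=; congr [:: _; _; _; _]; ring.
- have [a ->] := bracket_eq0 np' (anti0 _ _ rp'); have [b ->] := bracket_eq0 nq (anti0 _ _ sq).
  by exists (a * b); right; rewrite /tens /=; congr [:: _; _; _; _]; ring.
- have -> := both _ _ _ nq qq sq sq'; exists 0; left.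
  by rewrite /tens /= !mul0r !mulr0 oppr0.
Qed.

(** Columns 0 and 3 are isotropic with nonzero pairing, and columns 1 and 2 are isotropic and
    orthogonal to both, so [orthogonal_tens] leaves two shapes for each. Columns 1 and 2 have
    nonzero pairing, hence different shapes; the two assignments are the two values of [swap]. *)
Lemma segre_structure (g : 'M[K]_4) (mu : K) : mu != 0 ->
  g^T *m mxv zeta phi_N1 *m g = mu *: mxv zeta phi_N1 ->
  exists swap M N, [/\ kdet2 M != 0, kdet2 N != 0 & g = segre_mx swap M N].
Proof.
move=> mu0 gphi; pose t j := [seq g i j | i <- [:: o0; o1; o2; o3]].
have B i j : polar_N1 (t i) (t j) = mu * mxv zeta phi_N1 i j.
  have /matrixP/(_ i j) := gphi; rewrite [RHS]mxE => <-.
  rewrite mxE big_ord4 !mxE !big_ord4 !mxE /ent /polar_N1 /= cval0 cval1; ring.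
have gE (M : 'M[K]_4) : (forall j, t j = [seq M i j | i <- [:: o0; o1; o2; o3]]) -> g = M.
  move=> E; apply/matrixP=> i j; have [] := E j; move: i; exact: ord4P.
have B00 := B o0 o0; have B33 := B o3 o3; have B03 := B o0 o3; have B12 := B o1 o2.
have B11 := B o1 o1; have B22 := B o2 o2; have B01 := B o0 o1; have B02 := B o0 o2.
have B31 := B o3 o1; have B32 := B o3 o2.
rewrite !mxE /ent /= ?cval0 ?cval1 ?mulr0 ?mulr1
  in B00 B33 B03 B12 B11 B22 B01 B02 B31 B32.
have iso j : polar_N1 (t j) (t j) = 0 -> exists p q, t j = ktens p q.
  by move=> E; apply: isotropic_tens; apply: (mulfI two0); rewrite mulr0 -E /polar_N1 /=; ring.
have [p [q t0]] := iso _ B00; have [p' [q' t3]] := iso _ B33.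
rewrite t0 t3 in B01 B02 B31 B32 B03; rewrite polar_tens in B03.
have : kbracket p p' * kbracket q q' != 0 by rewrite B03.
rewrite mulf_eq0 negb_or => /andP[pp qq].
have [c t1] := orthogonal_tens pp qq (erefl 4 : size (t o1) = 4) B11 B01 B31.
have [d t2] := orthogonal_tens pp qq (erefl 4 : size (t o2) = 4) B22 B02 B32.
have cancel (a b : K) : mu * (a * b) = - mu -> a != 0 /\ b = - a^-1.
  move=> E; have ab : a * b = - 1 by apply: (mulfI mu0); rewrite E mulrN1.
  have a0 : a != 0.
    by apply: contraTneq (oner_neq0 K) => a0; rewrite -oppr_eq0 -ab a0 mul0r eqxx.
  by split=> //; apply: (mulfI a0); rewrite ab mulrN divff.
case: t1 t2 => t1 [] t2; rewrite t1 t2 /polar_N1 /tens /= in B12.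
- by case/eqP: mu0; rewrite -B12; ring.
- have [c0' dE] : c != 0 /\ d = - c^-1.
    by apply: cancel; rewrite -{1}B03 -B12 /bracket; ring.
  (* The pairing of columns 1 and 2 gives cd = -1, so c can be absorbed into the second columns of M
     and N without changing their tensor product. *)
  exists false, ((p.1, c^-1 * p'.1), (p.2, c^-1 * p'.2)), ((q.1, c * q'.1), (q.2, c * q'.2)).
  split; first by rewrite /det2 /bracket /= (_ : _ - _ = c^-1 * kbracket p p');
    [rewrite mulf_neq0 ?invr_eq0 | rewrite /bracket; ring].
    by rewrite /det2 /bracket /= (_ : _ - _ = c * kbracket q q');
    [rewrite mulf_neq0 | rewrite /bracket; ring].
  apply: gE; apply: ord4P; rewrite ?t0 ?t1 ?t2 ?t3 /= !mxE /tens /= ?dE;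
  by congr [:: _; _; _; _]; field.
- have [c0' dE] : c != 0 /\ d = - c^-1.
    by apply: cancel; rewrite -{1}B03 -B12 /bracket; ring.
  exists true, ((p.1, c * p'.1), (p.2, c * p'.2)), ((q.1, c^-1 * q'.1), (q.2, c^-1 * q'.2)).
  split; first by rewrite /det2 /bracket /= (_ : _ - _ = c * kbracket p p');
    [rewrite mulf_neq0 | rewrite /bracket; ring].
    by rewrite /det2 /bracket /= (_ : _ - _ = c^-1 * kbracket q q');
    [rewrite mulf_neq0 ?invr_eq0 | rewrite /bracket; ring].
  apply: gE; apply: ord4P; rewrite ?t0 ?t1 ?t2 ?t3 /= !mxE /tens /= ?dE;
  by congr [:: _; _; _; _]; field.
- by case/eqP: mu0; rewrite -B12; ring.
Qed.

Local Notation ksubstl := (substl (@GRing.add K) *%R).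
Local Notation ksubstr := (substr kcn (@GRing.add K) *%R).

Lemma form33_subst (M N : mat2 K) k u v :
  kform33 (ksubstr N (ksubstl M k)) u v = kform33 k (kapply2 M u) (kapply2 N v).
Proof.
have left k' u' v' : kform33 (ksubstl M k') u' v' = kform33 k' (kapply2 M u') v'.
  case: k' M u' v' => [[[[[[? ?] ?] ?] [[[? ?] ?] ?]] [[[? ?] ?] ?]] [[[? ?] ?] ?]]
    [[? ?] [? ?]] [? ?] [? ?].
  by rewrite /form33 /cube /polar3 /=; congr (_ * _ + _ * _ + _ * _ + _ * _); ring.
have right c v' : cubic_at (@GRing.add K) *%R (substr3 kcn (@GRing.add K) *%R N c) v'
    = cubic_at (@GRing.add K) *%R c (kapply2 N v').
  by case: c N v' => [[[? ?] ?] ?] [[? ?] [? ?]] [? ?] /=; ring.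
rewrite -left; move: (ksubstl M k) => [[[k0 k1] k2] k3].
rewrite /form33 -right; congr cubic_at.
by rewrite /cube /polar3 /= !vlin_substr.
Qed.

Lemma form33_scale (c d : K) k u v :
  kform33 k (c * u.1, c * u.2) (d * v.1, d * v.2) = (c * d) ^+ 3 * kform33 k u v.
Proof.
case: k u v => [[[[[[? ?] ?] ?] [[[? ?] ?] ?]] [[[? ?] ?] ?]] [[[? ?] ?] ?]] [? ?] [? ?].
by rewrite /form33 /cube /polar3 /=; ring.
Qed.

Definition scale_tensor (r : K) : tensor K -> tensor K := map_tensor ( *%R r).

Lemma form33_scale_tensor r k u v : kform33 (scale_tensor r k) u v = r * kform33 k u v.
Proof.
case: k u v => [[[[[[? ?] ?] ?] [[[? ?] ?] ?]] [[[? ?] ?] ?]] [[[? ?] ?] ?]] [? ?] [? ?].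
by rewrite /form33 /cube /polar3 /=; ring.
Qed.

Lemma covariant_scale_tensor r k u : kcovariant (scale_tensor r k) u = r ^+ 4 * kcovariant k u.
Proof.
pose s c := map_vec ( *%R r) c : vec K.
have lin a p b q : vlin (@GRing.add K) *%R a (s p) b (s q) = s (vlin (@GRing.add K) *%R a p b q).
  by case: p q => [[[? ?] ?] ?] [[[? ?] ?] ?]; rewrite /s /=; congr (_, _, _, _); ring.
have sc a b c d : beta kcn (@GRing.add K) ksub *%R (s a) (s b) (s c) (s d)
    = r ^+ 4 * beta kcn (@GRing.add K) ksub *%R a b c d.
  case: a b c d => [[[? ?] ?] ?] [[[? ?] ?] ?] [[[? ?] ?] ?] [[[? ?] ?] ?].
  by rewrite /beta /=; ring.
case: k => [[[k0 k1] k2] k3].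
rewrite /scale_tensor /covariant /polar3 /= -!/(s _) !lin !sc.
by move: (beta _ _ _ _) => b; ring.
Qed.

(** Values at (x, 1) determine a cubic, first in v and then in u; in u the middle coefficients carry
    a factor 3, invertible modulo 11. *)
Lemma form33_inj (k k' : tensor K) : (forall u v, kform33 k u v = kform33 k' u v) -> k = k'.
Proof.
have three0 : 3%:R != 0 :> K by rewrite -(rmorph_nat emb) fmorph_eq0.
have cubic_inj (c c' : vec K) : (forall v, cubic_at (@GRing.add K) *%R c v
    = cubic_at (@GRing.add K) *%R c' v) -> c = c'.
  case: c c' => [[[a0 a1] a2] a3] [[[b0 b1] b2] b3] E.
  have [x|] := @cubic_coefs K emb (a0 - b0) (a1 - b1) (a2 - b2) (a3 - b3).
    have /eqP := E (x, 1); rewrite -subr_eq0 => /eqP <- /=; ring.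
  by move=> /subr0_eq-> /subr0_eq-> /subr0_eq-> /subr0_eq->.
move=> E; have {}E u : cube (@GRing.add K) *%R k u = cube (@GRing.add K) *%R k' u.
  by apply: cubic_inj => v; exact: E.
have coord (a0 a1 a2 a3 b0 b1 b2 b3 : K) : (forall x : K,
    x * (x * (x * a0 + 1 * a1) + 1 * (x * a1 + 1 * a2))
      + 1 * (x * (x * a1 + 1 * a2) + 1 * (x * a2 + 1 * a3)) =
    x * (x * (x * b0 + 1 * b1) + 1 * (x * b1 + 1 * b2))
      + 1 * (x * (x * b1 + 1 * b2) + 1 * (x * b2 + 1 * b3))) ->
    [/\ a0 = b0, a1 = b1, a2 = b2 & a3 = b3].
  move=> F.
  have [x|] := @cubic_coefs K emb (a0 - b0) (3%:R * (a1 - b1)) (3%:R * (a2 - b2)) (a3 - b3).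
    have /eqP := F x; rewrite -subr_eq0 => /eqP <-; ring.
  move=> /subr0_eq-> /eqP e1 /eqP e2 /subr0_eq->; split=> //.
    by move: e1; rewrite mulf_eq0 (negbTE three0) subr_eq0 => /eqP.
  by move: e2; rewrite mulf_eq0 (negbTE three0) subr_eq0 => /eqP.
case: k k' E => [[[[[[? ?] ?] ?] [[[? ?] ?] ?]] [[[? ?] ?] ?]] [[[? ?] ?] ?]]
  [[[[[[? ?] ?] ?] [[[? ?] ?] ?]] [[[? ?] ?] ?]] [[[? ?] ?] ?]] E.
have [-> -> -> ->] := coord _ _ _ _ _ _ _ _ (fun x => congr1 (fun c => c.1.1.1) (E (x, 1))).
have [-> -> -> ->] := coord _ _ _ _ _ _ _ _ (fun x => congr1 (fun c => c.1.1.2) (E (x, 1))).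
have [-> -> -> ->] := coord _ _ _ _ _ _ _ _ (fun x => congr1 (fun c => c.1.2) (E (x, 1))).
by have [-> -> -> ->] := coord _ _ _ _ _ _ _ _ (fun x => congr1 (fun c => c.2) (E (x, 1))).
Qed.

Lemma covariant_zero (M N : mat2 K) k k' (r : K) u : r != 0 ->
  (forall u v, kform33 k (kapply2 M u) (kapply2 N v) = r * kform33 k' u v) ->
  kdet2 M != 0 -> kdet2 N != 0 -> kcovariant k' u = 0 -> kcovariant k (kapply2 M u) = 0.
Proof.
move=> r0 E dM dN k'u; have {}E : ksubstr N (ksubstl M k) = scale_tensor r k'.
  by apply: form33_inj => u' v'; rewrite form33_subst form33_scale_tensor.
have := covariant_scale_tensor r k' u; rewrite -E covariant_substr covariant_substl k'u mulr0.
by move/eqP; rewrite mulf_eq0 (negbTE (expf_neq0 6 dN)) mulf_eq0 (negbTE (expf_neq0 3 dM)) => /eqP.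
Qed.

Definition ktensor (A : cmx) : tensor K := map_tensor (cval zeta) (tensor_of A).

Lemma cpoly_covariant_eval (A : cmx) (u : pt K) :
  kev zeta (cpoly_covariant (map_tensor (@Ring_polynom.PEc F121) (tensor_of A))) u
  = kcovariant (ktensor A) u.
Proof.
have cnE k : covariant (fun n => cval zeta (cst n)) (@GRing.add K) ksub *%R k u = kcovariant k u.
  case: k => [[[k0 k1] k2] k3]; rewrite /covariant /jet_covariant /=.
  have bE p q r s : beta (fun n => cval zeta (cst n)) (@GRing.add K) ksub *%R p q r s
      = beta kcn (@GRing.add K) ksub *%R p q r s.
    case: p q r s => [[[? ?] ?] ?] [[[? ?] ?] ?] [[[? ?] ?] ?] [[[? ?] ?] ?].
    by rewrite /beta /= !(cval_cst zeta char11).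
  by rewrite !bE !(cval_cst zeta char11).
rewrite -cnE /ktensor; move: (tensor_of A) =>
  [[[[[[? ?] ?] ?] [[[? ?] ?] ?]] [[[? ?] ?] ?]] [[[? ?] ?] ?]].
by case: u {cnE}.
Qed.

Lemma tensor_testP (p : cpoly) (A : cmx) (swap : bool) (u v : pt K) :
  tensor_test p A swap ->
  3%:R * ceval zeta (if swap then ktens v u else ktens u v) p = kform33 (ktensor A) u v.
Proof.
case: u v => [u1 u2] [v1 v2] /(ceval_eq char11 zeta_root [:: u1; u2; v1; v2]) E.
apply: etrans (etrans _ E) _.
  rewrite [RHS]/ceval [RHS]/= -/(ceval zeta _ _) ceval_subst (cval_cst zeta char11).
  by case: swap {E}.
rewrite /ktensor; move: (tensor_of A) =>
  [[[[[[? ?] ?] ?] [[[? ?] ?] ?]] [[[? ?] ?] ?]] [[[? ?] ?] ?]].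
by [].
Qed.

(** Two forms are allowed because an automorphism exchanging the factors relates F to its transpose,
    and maps the roots on one factor to those on the other. *)
Lemma line_map (A A' : cmx) (R R' : seq (pt F121)) (c c' : F121) (M N : mat2 K) (r : K) :
  covariant_test A R c -> covariant_test A' R' c' -> points_test R' R ->
  r != 0 -> kdet2 M != 0 -> kdet2 N != 0 ->
  (forall u v, kform33 (ktensor A) (kapply2 M u) (kapply2 N v) = r * kform33 (ktensor A') u v) ->
  exists2 M0, M0 \in candidates R' R & exists2 d, d != 0 & M = scale2 d (mat2_val zeta M0).
Proof.
move=> /andP[rootsA nc] /andP[rootsA' nc'] pR r0 dM dN E.
have [_ root_R] := roots_testP emb zeta_root rootsA nc.
have [R'_root _] := roots_testP emb zeta_root rootsA' nc'.
apply: (candidatesP char11 zeta_root pR dM) => u /R'_root; rewrite cpoly_covariant_eval => u0.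
by apply: root_R; rewrite cpoly_covariant_eval; apply: covariant_zero r0 E dM dN u0.
Qed.

Section Elements.
Variables (P : {mpoly K[4]}) (p : cpoly) (A A' : cmx) (R R' : seq (pt F121)).
Variables (c c' : F121) (L : seq cmx).
Hypothesis PE : P = ceval zeta%:MP (vars K) p.
Hypothesis tensors : tensor_test p A false && tensor_test p A' true.
Hypothesis covariants : covariant_test A R c && covariant_test A' R' c'.
Hypothesis points : [&& points_test R R, points_test R' R', points_test R R' & points_test R' R].
Hypothesis check : segre_check p L false (candidates R R) (candidates R' R').
Hypothesis check_swap : segre_check p L true (candidates R' R) (candidates R R').

Lemma segre_elements (g : 'M[K]_4) : in_GK (map_mpoly emb Q_N1) P g ->
  exists B (k : K), [/\ k != 0, cmem (cnorm B) L & g = k *: mxv zeta B].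
Proof.
move=> gG; have [r r0 ev] := GK_eval (cQ_N1E emb zeta) PE gG.
case: gG => _ [mu mu0 gphi] _; rewrite (sym_coef_N1 emb zeta) in gphi.
have [swap [M [N [dM dN gE]]]] := segre_structure mu0 gphi.
have three0 : 3%:R != 0 :> K by rewrite -(rmorph_nat emb) fmorph_eq0.
case/andP: tensors => tA tA'; case/andP: covariants => cA cA'; case/and4P: points => p1 p2 p3 p4.
pose F u v := ceval zeta (ktens u v) p.
have {}ev u v : F (kapply2 M (if swap then v else u)) (kapply2 N (if swap then u else v))
    = r * F u v.
  rewrite /F -(ev (fun i => nth 0 (ktens u v) i)).
    by rewrite gE segre_mx_tens; case: swap {gE}.
  by rewrite /ceval /= (cval_cst zeta char11); ring.
have AF u v : kform33 (ktensor A) u v = 3%:R * F u v.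
  by rewrite -(tensor_testP _ _ tA).
have AF' u v : kform33 (ktensor A') u v = 3%:R * F v u.
  by rewrite -(tensor_testP _ _ tA').
have hom x y u v : F (x * u.1, x * u.2) (y * v.1, y * v.2) = (x * y) ^+ 3 * F u v.
  by apply: (mulfI three0); rewrite -AF form33_scale AF; ring.
(* When the factors are exchanged, M goes from the second line to the first, hence from [R'] to
   [R]. *)
have [M0 M0c [x x0 ME]] : exists2 M0, M0 \in candidates (if swap then R' else R) R
    & exists2 d, d != 0 & M = scale2 d (mat2_val zeta M0).
  case: swap ev {gE} => ev.
    by apply: (line_map cA cA' p4 r0 dM dN) => u v; rewrite AF AF' ev; ring.
  by apply: (line_map cA cA p1 r0 dM dN) => u v; rewrite !AF ev; ring.
have [N0 N0c [y y0 NE]] : exists2 N0, N0 \in candidates (if swap then R else R') R'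
    & exists2 d, d != 0 & N = scale2 d (mat2_val zeta N0).
  case: swap ev {gE M0c} => ev.
    by apply: (line_map cA' cA p3 r0 dN dM) => u v; rewrite AF AF' ev; ring.
  by apply: (line_map cA' cA' p2 r0 dN dM) => u v; rewrite !AF' ev; ring.
have cformE u v : cval zeta (cform p u v) = F (pt_val zeta u) (pt_val zeta v).
  rewrite /cform (cceval_val char11 zeta_root) /tens /=.
  by rewrite (cvalN zeta char11) !(cvalM char11 zeta_root).
have val u v : (x * y) ^+ 3 * cval zeta (if swap then cform p (capply2 M0 v) (capply2 N0 u)
    else cform p (capply2 M0 u) (capply2 N0 v)) = r * cval zeta (cform p u v).
  rewrite cformE -ev ME NE !apply2_scale hom.
  by case: swap {ev gE M0c N0c}; rewrite cformE !(apply2_val char11 zeta_root).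
have xy0 : x * y != 0 by rewrite mulf_neq0.
have eL : cmem (cnorm (csegre_mx swap M0 N0)) L.
  have : segre_check p L swap (candidates (if swap then R' else R) R)
    (candidates (if swap then R else R') R') by case: swap {ev gE M0c N0c val}.
  move=> /allP/(_ _ M0c)/allP/(_ _ N0c); cbv beta.
  case: ifP => // /hasP[_ /allpairsP[[u v] [_ _ ->]]].
  case/hasP=> _ /allpairsP[[u' v'] [_ _ ->]] /ceqP[].
  apply: (cval_inj char11 zeta_root); rewrite !(cvalM char11 zeta_root).
  by apply: (mulfI (expf_neq0 3 xy0)); rewrite mulrA val [RHS]mulrCA val; ring.
exists (csegre_mx swap M0 N0), (x * y); split=> //.
by rewrite gE ME NE segre_mx_scale csegre_mx_val.
Qed.
End Elements.

End Segre.

(* A generator A of the theorem with the data (mu, h, m): the scaling factor of the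
   quadric, the coefficients of the form h with A.P - P = hQ, and the order of A. *)
Definition generator : Type := cmx * (F121 * seq F121 * nat).
Definition generator_test (phi : cmx) (q p : cpoly) (A : generator) : bool :=
  let: (A, (mu, s, m)) := A in order_test A m && GK_test phi q p A mu s.
Definition word_products (U V : seq (seq nat)) : seq (seq nat) :=
  [seq u ++ v | u <- U, v <- V].
Definition powers (k n : nat) : seq (seq nat) := [seq nseq i k | i <- iota 0 n].
Definition group_test (gens : seq generator) (words : seq (seq nat)) (m : nat) : bool :=
  cuniq (elements [seq A.1 | A <- gens] words) && (size words == m).

Lemma curve_group (K : fieldType) (emb : {rmorphism 'F_11 -> K}) (zeta : K)
    (zeta_root : zeta ^+ 2 + 7 * zeta + 2 = 0) (Q P : {mpoly K[4]}) (phi : cmx)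
    (q p : cpoly) (gens : seq generator) (words : seq (seq nat)) (m : nat) :
  Q = ceval zeta%:MP (vars K) q -> P = ceval zeta%:MP (vars K) p ->
  sym_coef_mx Q = mxv zeta phi ->
  Q%:M = (var_col K 4)^T *m map_mx (@mpolyC 4 K) (sym_coef_mx Q) *m var_col K 4 :> 'M_1 ->
  all (generator_test phi q p) gens -> group_test gens words m ->
  (forall g, in_GK Q P g -> exists A (c : K),
    [/\ c != 0, cmem (cnorm A) (elements [seq A.1 | A <- gens] words) & g = c *: mxv zeta A]) ->
  has_order (Aut Q P) m /\ generated_by (Aut Q P) [seq mxv zeta A.1 | A <- gens].
Proof.
move=> QE PE phiE quad /allP gens_ok group_ok GK_elements.
have char11 := K_char11 emb.
have gens_GK A : A \in [seq A.1 | A <- gens] -> in_GK Q P (mxv zeta A).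
  case/mapP=> -[B [[mu s] n]] /gens_ok /andP[ordB testB] ->.
  apply: (GK_testP emb zeta_root QE PE phiE _ testB).
  exact: (order_test_unit char11 zeta_root ordB).
split; first exact: (Aut_has_order char11 zeta_root quad gens_GK group_ok GK_elements).
rewrite (map_comp (mxv zeta)).
exact: (Aut_generated char11 zeta_root quad gens_GK GK_elements).
Qed.

(** * Generators, words and roots for the nine curves, and the resulting groups *)

Definition zexp (n : nat) : F121 := cexp zc n.
Definition cdiag (a b c d : F121) : cmx :=
  [:: a; c0; c0; c0; c0; b; c0; c0; c0; c0; c; c0; c0; c0; c0; d].
Definition cblock (s : seq F121) : cmx := [:: c1; c0; c0; c0] ++
  flatten [seq c0 :: [seq nth c0 s (3 * i + j) | j <- iota 0 3] | i <- iota 0 3].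
Definition zero4 : seq F121 := [:: c0; c0; c0; c0].

Definition crows (s : seq nat) : cmx := map cst s.
Definition gens1 : seq generator := Eval vm_compute in
  [:: (crows [:: 6; 3; 5; 3; 1; 6; 1; 5; 5; 3; 6; 3; 1; 5; 1; 6],
        (c1, map cst [:: 7; 2; 7; 2], 2));
      (crows [:: 0; 6; 0; 10; 0; 8; 0; 7; 1; 0; 2; 0; 6; 0; 3; 0],
        (c1, map cst [:: 9; 1; 5; 7], 6))]%N.
Definition words1 := word_products (powers 0 2) (powers 1 6).
(** Exponents of [zeta] are reduced modulo 120, here and below: [zexp 114] is its power -6. *)
Definition gens2 : seq generator := Eval vm_compute in
  [:: (cdiag (cst 10) c1 c1 (cst 10), (c1, zero4, 2));
      ([:: c0; c0; c0; zexp 114; c0; c0; cst 7; c0; c0; cst 8; c0; c0; zexp 6; c0; c0; c0],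
        (c1, zero4, 2))]%N.
Definition words2 := word_products (powers 0 2) (powers 1 2).
Definition gens3 : seq generator := Eval vm_compute in
  [:: (crows [:: 0; 0; 5; 2; 7; 6; 9; 8; 0; 0; 8; 9; 2; 6; 1; 8],
        (c1, map cst [:: 1; 4; 10; 0], 4));
      (crows [:: 9; 5; 2; 5; 1; 3; 3; 2; 8; 5; 3; 5; 4; 8; 1; 9],
        (c1, map cst [:: 1; 2; 3; 2], 2))]%N.
(** Powers of the first generator times six coset representatives of the subgroup that it
    generates. *)
Definition words3 := word_products (powers 0 4)
  [:: [::]; [:: 1]; [:: 1; 0]; [:: 1; 0; 0]; [:: 1; 0; 1]; [:: 1; 0; 0; 1]]%N.
Definition gens4 : seq generator := Eval vm_compute in
  [:: (cblock (map cst [:: 2; 2; 10; 6; 5; 9; 2; 5; 2]), (c1, map cst [:: 0; 2; 2; 3], 6));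
      (cdiag c1 (zexp 80) (zexp 80) (zexp 80), (zexp 40, zero4, 3));
      (cblock (map cst [:: 2; 9; 10; 6; 6; 9; 2; 6; 2]), (c1, map cst [:: 0; 2; 9; 3], 2))]%N.
Definition words4 := word_products (powers 0 6) (word_products (powers 1 3) (powers 2 2)).
Definition gens5 : seq generator := Eval vm_compute in
  [:: (cblock (map cst [:: 5; 2; 4; 8; 0; 9; 9; 3; 5]), (c1, map cst [:: 0; 5; 0; 4], 4));
      (cblock (map cst [:: 3; 9; 3; 6; 6; 9; 5; 6; 3]), (c1, map cst [:: 0; 7; 4; 5], 2));
      (cdiag c1 (zexp 80) (zexp 80) (zexp 80), (zexp 40, zero4, 3))]%N.
Definition words5 := word_products (word_products (powers 0 4) (powers 2 3))
  [:: [::]; [:: 1]; [:: 1; 0]; [:: 1; 0; 0]; [:: 1; 0; 1]; [:: 1; 0; 0; 1]]%N.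
Definition gens6 : seq generator := Eval vm_compute in
  [:: (cdiag c1 (zexp 80) (zexp 70) (zexp 60), (zexp 20, zero4, 12%N))].
Definition gens7 : seq generator := Eval vm_compute in
  [:: (cdiag c1 c1 (zexp 80) (zexp 40), (zexp 40, zero4, 3%N))].
Definition gens8 : seq generator := Eval vm_compute in
  [:: (cblock [:: zexp 4; zexp 80; cst 7; zexp 112; zexp 44; c1; zexp 28; zexp 32; cst 7],
        (zexp 40, [:: c0; lin 4 5; cst 7; lin 10 8], 3));
      (cblock [:: cst 7; zexp 40; zexp 44; zexp 32; cst 7; zexp 40; zexp 28; zexp 32; cst 7],
        (c1, [:: c0; lin 4 5; cst 7; lin 10 8], 2))]%N.
Definition words8 := word_products (powers 0 3) [:: [::]; [:: 1]; [:: 1; 0]; [:: 1; 0; 0]]%N.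
Definition gens9 : seq generator := Eval vm_compute in
  [:: (cdiag c1 (zexp 40) (zexp 80) c1, (zexp 40, zero4, 3%N))].

(** For each split curve: the cubic restricted to P^1 x P^1, its transpose serving the second
    factor, and the roots of the two covariants. These data are certified by [tensor_test] and
    [covariant_test]. *)
Definition form1 : cmx := map cst [:: 0; 1; 0; 4; 10; 0; 9; 10; 1; 3; 3; 8; 3; 7; 4;
  4]%N.
Definition roots1 : seq (pt F121) := [:: (lin 8 1, c1); (lin 10 3, c1); (lin 10 4, c1);
  (lin 4 7, c1); (lin 0 8, c1); (lin 1 10, c1)].
Definition form1_tr : cmx := map cst [:: 0; 10; 1; 3; 1; 0; 3; 7; 0; 9; 3; 4; 4; 10; 8;
  4]%N.
Definition roots1_tr : seq (pt F121) := [:: (lin 0 1, c1); (lin 7 4, c1); (lin 6 5, c1);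
  (lin 4 6, c1); (lin 1 7, c1); (lin 4 10, c1)].
Definition form2 : cmx := map cst [:: 0; 1; 0; 1; 10; 0; 10; 0; 0; 7; 0; 4; 9; 0; 2;
  0]%N.
Definition roots2 : seq (pt F121) := [:: (c1, c0); (c0, c1); (lin 1 2, c1); (lin 2 2,
  c1); (lin 9 9, c1); (lin 10 9, c1)].
Definition form2_tr : cmx := map cst [:: 0; 10; 0; 9; 1; 0; 7; 0; 0; 10; 0; 2; 1; 0; 4;
  0]%N.
Definition roots2_tr : seq (pt F121) := [:: (c1, c0); (c0, c1); (lin 5 5, c1); (lin 8 5,
  c1); (lin 3 6, c1); (lin 6 6, c1)].
Definition form3 : cmx := map cst [:: 0; 1; 0; 9; 10; 0; 5; 5; 1; 8; 6; 2; 10; 2; 4;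
  1]%N.
Definition roots3 : seq (pt F121) := [:: (lin 7 1, c1); (lin 0 3, c1); (lin 6 3, c1);
  (lin 1 8, c1); (lin 7 8, c1); (lin 0 10, c1)].
Definition form3_tr : cmx := map cst [:: 0; 10; 1; 10; 1; 0; 8; 2; 0; 5; 6; 4; 9; 5; 2;
  1]%N.
Definition roots3_tr : seq (pt F121) := [:: (lin 6 1, c1); (lin 5 3, c1); (lin 10 3,
  c1); (lin 0 8, c1); (lin 6 8, c1); (lin 10 10, c1)].

Section SplitCurves.
Variables (K : closedFieldType) (emb : {rmorphism 'F_11 -> K}) (zeta : K).
Hypothesis zeta_root : zeta ^+ 2 + 7 * zeta + 2 = 0.
Local Notation AutN1 P := (Aut (map_mpoly emb Q_N1) (map_mpoly emb P)).

Lemma segre_group (P : {mpoly 'F_11[4]}) (p : cpoly) (A A' : cmx) (R R' : seq (pt F121))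
    (c c' : F121) (gens : seq generator) (words : seq (seq nat)) (m : nat) :
  let L := elements [seq B.1 | B <- gens] words in
  map_mpoly emb P = ceval zeta%:MP (vars K) p ->
  tensor_test p A false && tensor_test p A' true ->
  covariant_test A R c && covariant_test A' R' c' ->
  [&& points_test R R, points_test R' R', points_test R R' & points_test R' R] ->
  segre_check p L false (candidates R R) (candidates R' R') ->
  segre_check p L true (candidates R' R) (candidates R R') ->
  all (generator_test phi_N1 cQ_N1 p) gens -> group_test gens words m ->
  has_order (AutN1 P) m /\ generated_by (AutN1 P) [seq mxv zeta B.1 | B <- gens].
Proof.
move=> L PE tensors covs points check check_swap gens_ok group_ok.
apply: (curve_group emb zeta_root (cQ_N1E emb zeta) PE (sym_coef_N1 emb zeta)
  (quadratic_N1 emb zeta) gens_ok group_ok).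
exact: (segre_elements zeta_root PE tensors covs points check check_swap).
Qed.

Lemma Aut1 : has_order (AutN1 P1_alc) 12 /\
  generated_by (AutN1 P1_alc) [seq mxv zeta A.1 | A <- gens1].
Proof.
apply: (segre_group (words := words1) (A := form1) (A' := form1_tr) (R := roots1)
  (R' := roots1_tr) (c := cst 6) (c' := cst 8) (cP1E emb zeta)); by vm_compute.
Qed.

Lemma Aut2 : has_order (AutN1 P2_alc) 4 /\
  generated_by (AutN1 P2_alc) [seq mxv zeta A.1 | A <- gens2].
Proof.
apply: (segre_group (words := words2) (A := form2) (A' := form2_tr) (R := roots2)
  (R' := roots2_tr) (c := c1) (c' := cst 6) (cP2E emb zeta)); by vm_compute.
Qed.

Lemma Aut3 : has_order (AutN1 P3_alc) 24 /\
  generated_by (AutN1 P3_alc) [seq mxv zeta A.1 | A <- gens3].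
Proof.
apply: (segre_group (words := words3) (A := form3) (A' := form3_tr) (R := roots3)
  (R' := roots3_tr) (c := cst 7) (c' := cst 4) (cP3E emb zeta)); by vm_compute.
Qed.

End SplitCurves.

(** At x = 0 the form x^3 + xq + f reduces to f, so only q has to be supplied for each curve. Again
    5 is -1/2. *)
Definition cone_sextic (p : cpoly) : cpoly :=
  csubst [:: 0%:F; 'V_0 ^+ 2; 'V_0 * 'V_1; 5%:F * 'V_1 ^+ 2]%cpoly p.

Section ConeCurves.
Variables (K : closedFieldType) (emb : {rmorphism 'F_11 -> K}) (zeta : K).
Hypothesis zeta_root : zeta ^+ 2 + 7 * zeta + 2 = 0.
Local Notation AutDege P := (Aut (map_mpoly emb Q_Dege) (map_mpoly emb P)).

Lemma cone_group (P : {mpoly 'F_11[4]}) (p q rt : cpoly) (R : seq (pt F121)) (c : F121)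
    (k : nat) (gens : seq generator) (words : seq (seq nat)) (m : nat) :
  let f := cone_sextic p in
  let L := elements [seq A.1 | A <- gens] words in
  map_mpoly emb P = ceval zeta%:MP (vars K) p ->
  [&& cone_cubic p q f, binary_hom 4 q & binary_hom 6 f] ->
  rt = f \/ rt = q -> roots_test rt R c k && ~~ ceq c c0 -> cone_check f q R L ->
  all (generator_test phi_Dege cQ_Dege p) gens -> group_test gens words m ->
  has_order (AutDege P) m /\ generated_by (AutDege P) [seq mxv zeta A.1 | A <- gens].
Proof.
move=> f L PE pE rtE rootsR check gens_ok group_ok.
apply: (curve_group emb zeta_root (cQ_DegeE emb zeta) PE (sym_coef_Dege emb zeta)
  (quadratic_Dege emb zeta) gens_ok group_ok).
exact: (cone_elements zeta_root PE pE rtE rootsR check).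
Qed.

Lemma Aut4 : has_order (AutDege P4_alc) 36 /\
  generated_by (AutDege P4_alc) [seq mxv zeta A.1 | A <- gens4].
Proof.
apply: (cone_group (words := words4) (q := 0%:F) (c := c1) (k := 0)
  (R := [:: (c1, c1); (cst 2, c1); (cst 3, c1); (cst 8, c1); (cst 9, c1); (cst 10, c1)])
  (cP4E emb zeta) _ (or_introl erefl)); by vm_compute.
Qed.

Lemma Aut5 : has_order (AutDege P5_alc) 72 /\
  generated_by (AutDege P5_alc) [seq mxv zeta A.1 | A <- gens5].
Proof.
apply: (cone_group (words := words5) (q := 0%:F) (c := cst 2) (k := 0)
  (R := [:: (lin 5 2, c1); (lin 9 2, c1); (lin 5 3, c1); (lin 6 8, c1); (lin 2 9, c1);
            (lin 6 9, c1)])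
  (cP5E emb zeta) _ (or_introl erefl)); by vm_compute.
Qed.

Lemma Aut7 : has_order (AutDege P7_alc) 3 /\
  generated_by (AutDege P7_alc) [seq mxv zeta A.1 | A <- gens7].
Proof.
(* Here f is s^6 + 7 s^3 t^3 + 4 t^6 = (s^3 + 9 t^3)^2, whence [k := 1] and only three roots. *)
apply: (cone_group (words := powers 0 3) (q := 5%:F * 'V_0 * 'V_1 ^+ 3) (c := c1) (k := 1)
  (R := [:: (cst 7, c1); (lin 5 4, c1); (lin 10 7, c1)])
  (cP7E emb zeta) _ (or_introl erefl)); by vm_compute.
Qed.

Lemma Aut8 : has_order (AutDege P8_alc) 12 /\
  generated_by (AutDege P8_alc) [seq mxv zeta A.1 | A <- gens8].
Proof.
apply: (cone_group (words := words8) (q := 'V_0 ^+ 3 * 'V_1 + 3%:F * 'V_1 ^+ 4)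
  (c := cst 10) (k := 0) (R := [:: (c1, c0); (cst 2, c1); (lin 6 2, c1); (lin 3 9, c1)])
  (cP8E emb zeta) _ (or_intror erefl)); by vm_compute.
Qed.

Lemma Aut9 : has_order (AutDege P9_alc) 3 /\
  generated_by (AutDege P9_alc) [seq mxv zeta A.1 | A <- gens9].
Proof.
apply: (cone_group (words := powers 0 3) (q := 'V_0 ^+ 3 * 'V_1 + 7%:F * 'V_1 ^+ 4)
  (c := cst 10) (k := 0) (R := [:: (c1, c0); (cst 5, c1); (lin 4 5, c1); (lin 2 6, c1)])
  (cP9E emb zeta) _ (or_intror erefl)); by vm_compute.
Qed.

(* Here q and f are powers of t and s, so the substitution (s, t) is diagonal. *)
Lemma Aut6 : has_order (AutDege P6_alc) 12 /\
  generated_by (AutDege P6_alc) [seq mxv zeta A.1 | A <- gens6].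
Proof.
have char11 := K_char11 emb.
pose q : cpoly := (3%:F * 'V_1 ^+ 4)%cpoly; pose f : cpoly := ('V_0 ^+ 6)%cpoly.
apply: (curve_group emb zeta_root (words := powers 0 12) (cQ_DegeE emb zeta) (cP6E emb zeta)
  (sym_coef_Dege emb zeta) (quadratic_Dege emb zeta)) => [||g]; [by vm_compute | by vm_compute |].
have cubic : cone_cubic cP6_alc q f by vm_compute.
have qhom : binary_hom 4 q by vm_compute.
have fhom : binary_hom 6 f by vm_compute.
have three0 : 3%:R != 0 :> K by rewrite -(rmorph_nat emb) fmorph_eq0.
move=> /(cone_GK zeta_root (cP6E emb zeta) cubic qhom fhom)[[[a b] [c d]] [k [k0 _ gE inv]]].
have qE u : kev zeta q u = 3%:R * u.2 ^+ 4 by rewrite /kev /ceval /= (cval_cst zeta char11).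
have fE u : kev zeta f u = u.1 ^+ 6 by [].
have c_0 : c = 0.
  have [+ _] := inv (1, 0); rewrite !qE /= mulr1 mulr0 addr0 expr0n mulr0 => /eqP.
  by rewrite mulf_eq0 (negbTE three0) expf_eq0 /= => /eqP.
have b_0 : b = 0.
  have [_] := inv (0, 1); rewrite !fE /= mulr1 mulr0 add0r expr0n => /eqP.
  by rewrite expf_eq0 /= => /eqP.
have a6 : a ^+ 6 = 1.
  by have [_] := inv (1, 0); rewrite !fE /= mulr1 mulr0 addr0 expr1n.
have d4 : d ^+ 4 = 1.
  have [+ _] := inv (0, 1); rewrite !qE /= mulr1 mulr0 add0r expr1n.
  exact: mulfI.
have [i i6 aE] := zeta_root_of_unity char11 zeta_root (erefl : (6 * 20)%N = 120%N) a6.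
have [j j4 dE] := zeta_root_of_unity char11 zeta_root (erefl : (4 * 30)%N = 120%N) d4.
(* The 24 pairs (i, j) yield 12 automorphisms, since M and -M act in the same way on the conic. *)
pose M i j : mat2 F121 := ((zexp (20 * i), c0), (c0, zexp (30 * j))).
exists (ccone_mx c1 (M i j)), k; split=> //.
  have : all (fun i => all (fun j => cmem (cnorm (ccone_mx c1 (M i j)))
    (elements [seq A.1 | A <- gens6] (powers 0 12))) (iota 0 4)) (iota 0 6) by vm_compute.
  by move/allP/(_ i)/(_ _)/allP; apply; rewrite mem_iota.
rewrite gE (ccone_mx_val emb zeta_root) cval1 /M /mat2_val /pt_val /= !(cvalX char11 zeta_root).
by rewrite cvalz !cval0 aE dE b_0 c_0.
Qed.

End ConeCurves.

(** * Matching the matrices of the statement with their computable versions *)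

Section Entries.
Variables (K : closedFieldType) (emb : {rmorphism 'F_11 -> K}) (zeta : K).
Hypothesis zeta_root : zeta ^+ 2 + 7 * zeta + 2 = 0.
Let char11 := K_char11 emb.

Lemma zeta_expV (n : nat) : (n <= 120)%N -> zeta ^- n = zeta ^+ (120 - n).
Proof.
move=> n120; have zprim := zeta_primitive char11 zeta_root.
have zn : zeta ^+ n != 0 by rewrite expf_neq0 // (prim_root_eq0 zprim).
by apply: (mulfI zn); rewrite divff // -exprD subnKC // prim_expr_order.
Qed.

Lemma small_entry (n : nat) (x : F121) : ceq (cst n) x -> n%:R = cval zeta x.
Proof. by move=> /ceqP <-; rewrite (cval_cst zeta char11). Qed.

Lemma opp_entry : -1 = cval zeta (d10, d0).
Proof. by rewrite -(ten_opp emb); apply: small_entry. Qed.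
End Entries.

Ltac match_entries emb root :=
  apply/matrixP; do 2![apply: ord4P]; rewrite !mxE /ent /= ?mulr1n ?mulr0n;
  first [ by rewrite cval0 | by rewrite cval1
    | exact: (opp_entry emb)
    | apply: (zeta_exp (K_char11 emb) root); by vm_compute
    | rewrite (zeta_expV emb root) //; apply: (zeta_exp (K_char11 emb) root); by vm_compute
    | apply: (small_entry emb); by vm_compute ].

Theorem proposition4p3p4 (K : closedFieldType) (iota : {rmorphism 'F_11 -> K})
    (K_algebraic : integralRange iota)
    (zeta : K) (zeta_root : zeta ^+ 2 + 7 * zeta + 2 = 0) :
  let AutN1 P := Aut (map_mpoly iota Q_N1) (map_mpoly iota P) in
  let AutDege P := Aut (map_mpoly iota Q_Dege) (map_mpoly iota P) in
  120.-primitive_root zeta /\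
  (* (1) *)
  (let A := mx4 [:: [:: 6; 3; 5; 3]; [:: 1; 6; 1; 5];
                    [:: 5; 3; 6; 3]; [:: 1; 5; 1; 6]] : 'M[K]_4 in
   let B := mx4 [:: [:: 0; 6; 0; 10]; [:: 0; 8; 0; 7];
                    [:: 1; 0; 2; 0]; [:: 6; 0; 3; 0]] : 'M[K]_4 in
   [/\ has_order (AutN1 P1_alc) 12, generated_by (AutN1 P1_alc) [:: A; B],
       elt_order (pgl A) 2 & elt_order (pgl B) 6]) /\
  (* (2) *)
  (let A := diag4 (-1) 1 1 (-1) : 'M[K]_4 in
   let B := mx4 [:: [:: 0; 0; 0; zeta ^- 6]; [:: 0; 0; 7; 0];
                    [:: 0; 8; 0; 0]; [:: zeta ^+ 6; 0; 0; 0]] : 'M[K]_4 in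
   [/\ has_order (AutN1 P2_alc) 4, generated_by (AutN1 P2_alc) [:: A; B],
       elt_order (pgl A) 2 & elt_order (pgl B) 2]) /\
  (* (3) *)
  (let A := mx4 [:: [:: 0; 0; 5; 2]; [:: 7; 6; 9; 8];
                    [:: 0; 0; 8; 9]; [:: 2; 6; 1; 8]] : 'M[K]_4 in
   let B := mx4 [:: [:: 9; 5; 2; 5]; [:: 1; 3; 3; 2];
                    [:: 8; 5; 3; 5]; [:: 4; 8; 1; 9]] : 'M[K]_4 in
   [/\ has_order (AutN1 P3_alc) 24, generated_by (AutN1 P3_alc) [:: A; B],
       elt_order (pgl A) 4 & elt_order (pgl B) 2]) /\
  (* (4) *)
  (let A := mx4 [:: [:: 1; 0; 0; 0]; [:: 0; 2; 2; 10];
                    [:: 0; 6; 5; 9]; [:: 0; 2; 5; 2]] : 'M[K]_4 in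
   let B := diag4 1 (zeta ^+ 80) (zeta ^+ 80) (zeta ^+ 80) : 'M[K]_4 in
   let C := mx4 [:: [:: 1; 0; 0; 0]; [:: 0; 2; 9; 10];
                    [:: 0; 6; 6; 9]; [:: 0; 2; 6; 2]] : 'M[K]_4 in
   [/\ has_order (AutDege P4_alc) 36,
       generated_by (AutDege P4_alc) [:: A; B; C],
       elt_order (pgl A) 6, elt_order (pgl B) 3 & elt_order (pgl C) 2]) /\
  (* (5) *)
  (let A := mx4 [:: [:: 1; 0; 0; 0]; [:: 0; 5; 2; 4];
                    [:: 0; 8; 0; 9]; [:: 0; 9; 3; 5]] : 'M[K]_4 in
   let B := mx4 [:: [:: 1; 0; 0; 0]; [:: 0; 3; 9; 3];
                    [:: 0; 6; 6; 9]; [:: 0; 5; 6; 3]] : 'M[K]_4 in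
   let C := diag4 1 (zeta ^+ 80) (zeta ^+ 80) (zeta ^+ 80) : 'M[K]_4 in
   [/\ has_order (AutDege P5_alc) 72,
       generated_by (AutDege P5_alc) [:: A; B; C],
       elt_order (pgl A) 4, elt_order (pgl B) 2 & elt_order (pgl C) 3]) /\
  (* (6) *)
  (let A := diag4 1 (zeta ^+ 80) (zeta ^+ 70) (-1) : 'M[K]_4 in
   has_order (AutDege P6_alc) 12 /\ generated_by (AutDege P6_alc) [:: A]) /\
  (* (7) *)
  (let A := diag4 1 1 (zeta ^- 40) (zeta ^+ 40) : 'M[K]_4 in
   has_order (AutDege P7_alc) 3 /\ generated_by (AutDege P7_alc) [:: A]) /\
  (* (8) *)
  (let A := mx4 [:: [:: 1; 0; 0; 0];
                    [:: 0; zeta ^+ 4; zeta ^- 40; 7];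
                    [:: 0; zeta ^- 8; zeta ^+ 44; 1];
                    [:: 0; zeta ^+ 28; zeta ^+ 32; 7]] : 'M[K]_4 in
   let B := mx4 [:: [:: 1; 0; 0; 0];
                    [:: 0; 7; zeta ^+ 40; zeta ^+ 44];
                    [:: 0; zeta ^+ 32; 7; zeta ^+ 40];
                    [:: 0; zeta ^+ 28; zeta ^+ 32; 7]] : 'M[K]_4 in
   [/\ has_order (AutDege P8_alc) 12, generated_by (AutDege P8_alc) [:: A; B],
       elt_order (pgl A) 3 & elt_order (pgl B) 2]) /\
  (* (9) *)
  (let A := diag4 1 (zeta ^+ 40) (zeta ^- 40) 1 : 'M[K]_4 in
   has_order (AutDege P9_alc) 3 /\ generated_by (AutDege P9_alc) [:: A]).
Proof.
move=> AutN1 AutDege.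
have order A m : order_test A m -> elt_order (pgl (mxv zeta A)) m.
  exact: (order_testP (K_char11 iota) zeta_root).
split; first exact: (zeta_primitive (K_char11 iota) zeta_root).
split=> [A B|].
  have EA : A = mxv zeta (nth cid [seq g.1 | g <- gens1] 0) by match_entries iota zeta_root.
  have EB : B = mxv zeta (nth cid [seq g.1 | g <- gens1] 1) by match_entries iota zeta_root.
  have [size gen] := Aut1 iota zeta_root.
  by rewrite EA EB; split=> //; apply: order; vm_compute.
split=> [A B|].
  have EA : A = mxv zeta (nth cid [seq g.1 | g <- gens2] 0) by match_entries iota zeta_root.
  have EB : B = mxv zeta (nth cid [seq g.1 | g <- gens2] 1) by match_entries iota zeta_root.
  have [size gen] := Aut2 iota zeta_root.
  by rewrite EA EB; split=> //; apply: order; vm_compute.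
split=> [A B|].
  have EA : A = mxv zeta (nth cid [seq g.1 | g <- gens3] 0) by match_entries iota zeta_root.
  have EB : B = mxv zeta (nth cid [seq g.1 | g <- gens3] 1) by match_entries iota zeta_root.
  have [size gen] := Aut3 iota zeta_root.
  by rewrite EA EB; split=> //; apply: order; vm_compute.
split=> [A B C|].
  have EA : A = mxv zeta (nth cid [seq g.1 | g <- gens4] 0) by match_entries iota zeta_root.
  have EB : B = mxv zeta (nth cid [seq g.1 | g <- gens4] 1) by match_entries iota zeta_root.
  have EC : C = mxv zeta (nth cid [seq g.1 | g <- gens4] 2) by match_entries iota zeta_root.
  have [size gen] := Aut4 iota zeta_root.
  by rewrite EA EB EC; split=> //; apply: order; vm_compute.
split=> [A B C|].
  have EA : A = mxv zeta (nth cid [seq g.1 | g <- gens5] 0) by match_entries iota zeta_root.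
  have EB : B = mxv zeta (nth cid [seq g.1 | g <- gens5] 1) by match_entries iota zeta_root.
  have EC : C = mxv zeta (nth cid [seq g.1 | g <- gens5] 2) by match_entries iota zeta_root.
  have [size gen] := Aut5 iota zeta_root.
  by rewrite EA EB EC; split=> //; apply: order; vm_compute.
split=> [A|].
  have -> : A = mxv zeta (nth cid [seq g.1 | g <- gens6] 0) by match_entries iota zeta_root.
  exact: (Aut6 iota zeta_root).
split=> [A|].
  have -> : A = mxv zeta (nth cid [seq g.1 | g <- gens7] 0) by match_entries iota zeta_root.
  exact: (Aut7 iota zeta_root).
split=> [A B|A].
  have EA : A = mxv zeta (nth cid [seq g.1 | g <- gens8] 0) by match_entries iota zeta_root.
  have EB : B = mxv zeta (nth cid [seq g.1 | g <- gens8] 1) by match_entries iota zeta_root.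
  have [size gen] := Aut8 iota zeta_root.
  by rewrite EA EB; split=> //; apply: order; vm_compute.
have -> : A = mxv zeta (nth cid [seq g.1 | g <- gens9] 0) by match_entries iota zeta_root.
exact: (Aut9 iota zeta_root).
Qed.
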